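(* Let $(TM,\lambda)$ be an EAP-space. For the dual $d$-connection $\widetilde D$ the curvature component $\widetilde S^\alpha_{\beta bc}$ vanishes identically, and the remaining curvature tensors can be expressed in the form (with $|$, $||$ the covariant derivatives of the canonical $d$-connection): (a) $\widetilde R^\alpha_{\beta\nu\mu}=\Lambda^\alpha_{\mu\nu|\beta}+\mathfrak S_{\beta,\mu,\nu}\,C^\alpha_{\beta a}R^a_{\mu\nu}$, (b) $\widetilde R^a_{b\nu\mu}=R^d_{\mu\nu}T^a_{db}$, (c) $\widetilde P^\alpha_{\beta\mu c}=\Lambda^\alpha_{\mu\beta||c}+\Lambda^\alpha_{\epsilon\beta}C^\epsilon_{\mu c}$, (d) $\widetilde P^a_{b\mu c}=T^a_{bc|\mu}+T^a_{db}P^d_{\mu c}$, (e) $\widetilde S^a_{bcd}=T^a_{dc||b}$. Consequently, (f) $\widetilde R_{\beta\nu}:=\widetilde R^\alpha_{\beta\nu\alpha}=-C_{\nu|\beta}+\mathfrak S_{\beta,\nu,\alpha}\,C^\alpha_{\beta a}R^a_{\alpha\nu}$, (g) $\widetilde{\mathcal R}:=g^{\beta\mu}\widetilde R_{\beta\mu}=-C^\mu{}_{|\mu}$, (h) $\widetilde P_{\beta c}:=-\widetilde P^\alpha_{\beta\alpha c}=C_{\beta||c}+\Lambda^\alpha_{\beta\epsilon}C^\epsilon_{\alpha c}$, (i) $\widetilde P_{b\mu}:=\widetilde P^a_{b\mu a}=C_{b|\mu}+T^a_{db}P^d_{\mu a}$, (j) $\widetilde S_{bd}:=\widetilde S^a_{bda}=-C_{d||b}$,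 (k) $\widetilde{\mathcal S}:=g^{bd}\widetilde S_{bd}=-C^d{}_{||d}$. Here $\mathfrak S_{\beta,\mu,\nu}$ denotes the sum over cyclic permutations of the lower indices: $\mathfrak S_{\beta,\mu,\nu}C^\alpha_{\beta a}R^a_{\mu\nu}=C^\alpha_{\beta a}R^a_{\mu\nu}+C^\alpha_{\mu a}R^a_{\nu\beta}+C^\alpha_{\nu a}R^a_{\beta\mu}$, and in (f) $\mathfrak S_{\beta,\nu,\alpha}C^\alpha_{\beta a}R^a_{\alpha\nu}=C^\alpha_{\beta a}R^a_{\alpha\nu}+C^\alpha_{\nu a}R^a_{\beta\alpha}+C^\alpha_{\alpha a}R^a_{\nu\beta}$.
   Context: Let $M$ be a smooth paracompact $n$-manifold, $TM$ its tangent bundle with induced local coordinates $(x^\mu,y^a)$, and $N=(N^a_\mu(x,y))$ a given nonlinear connection on $TM$. Greek indices denote horizontal and Latin indices vertical components; both run over $1,\dots,n$; repeated indices (including the mesh index $i$) are summed. Put $\dot\partial_a=\partial/\partial y^a$, $\delta_\mu=\partial/\partial x^\mu-N^a_\mu\dot\partial_a$ (adapted frame $(\delta_\mu,\dot\partial_a)$) and $R^a_{\mu\nu}=\delta_\nu N^a_\mu-\delta_\mu N^a_\nu$. A $d$-connection is a linear connection $D$ on $TM$ preserving by parallelism the horizontal and the vertical distribution; its coefficients $(\Gamma^\alpha_{\mu\nu},\Gamma^a_{b\nu},C^\alpha_{\mu c},C^a_{bc})$ are defined by $D_{\delta_\nu}\delta_\mu=\Gamma^\alpha_{\mu\nu}\delta_\alpha$,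 $D_{\delta_\nu}\dot\partial_b=\Gamma^a_{b\nu}\dot\partial_a$, $D_{\dot\partial_c}\delta_\mu=C^\alpha_{\mu c}\delta_\alpha$, $D_{\dot\partial_c}\dot\partial_b=C^a_{bc}\dot\partial_a$. Its $h$- and $v$-covariant derivatives are $T^{\alpha a}{}_{\beta b|\mu}=\delta_\mu T^{\alpha a}_{\beta b}+T^{\epsilon a}_{\beta b}\Gamma^\alpha_{\epsilon\mu}+T^{\alpha d}_{\beta b}\Gamma^a_{d\mu}-T^{\alpha a}_{\epsilon b}\Gamma^\epsilon_{\beta\mu}-T^{\alpha a}_{\beta d}\Gamma^d_{b\mu}$, $T^{\alpha a}{}_{\beta b||c}=\dot\partial_cT^{\alpha a}_{\beta b}+T^{\epsilon a}_{\beta b}C^\alpha_{\epsilon c}+T^{\alpha d}_{\beta b}C^a_{dc}-T^{\alpha a}_{\epsilon b}C^\epsilon_{\beta c}-T^{\alpha a}_{\beta d}C^d_{bc}$, similarly for other types. Its curvature $\mathbf R(X,Y)Z=D_XD_YZ-D_YD_XZ-D_{[X,Y]}Z$ has components $\mathbf R(\delta_\mu,\delta_\nu)\delta_\beta=R^\alpha_{\beta\mu\nu}\delta_\alpha$, $\mathbf R(\delta_\mu,\delta_\nu)\dot\partial_b=R^a_{b\mu\nu}\dot\partial_a$, $\mathbf R(\dot\partial_c,\delta_\nu)\delta_\beta=P^\alpha_{\beta\nu c}\delta_\alpha$, $\mathbf R(\dot\partial_c,\delta_\nu)\dot\partial_b=P^a_{b\nu c}\dot\partial_a$, $\mathbf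 R(\dot\partial_b,\dot\partial_c)\delta_\beta=S^\alpha_{\beta bc}\delta_\alpha$, $\mathbf R(\dot\partial_c,\dot\partial_d)\dot\partial_b=S^a_{bcd}\dot\partial_a$. Those of $\widetilde D$ carry a tilde. EAP-space $(TM,\lambda)$: $TM$ with $N$ and $n$ vector fields $\lambda_i=\lambda_i^\alpha\delta_\alpha+\lambda_i^a\dot\partial_a$ ($i=1,\dots,n$) defined globally on $TM$ with linearly independent horizontal parts and linearly independent vertical parts. $(\lambda_{i\alpha})$, $(\lambda_{ia})$ are the inverse matrices of $(\lambda_i^\alpha)$, $(\lambda_i^a)$. Metric: $g_{\alpha\beta}=\lambda_{i\alpha}\lambda_{i\beta}$, $g_{ab}=\lambda_{ia}\lambda_{ib}$, with inverses $g^{\alpha\beta}$, $g^{ab}$. Canonical $d$-connection: $\Gamma^\alpha_{\mu\nu}=\lambda_i^\alpha\delta_\nu\lambda_{i\mu}$, $\Gamma^a_{b\nu}=\lambda_i^a\delta_\nu\lambda_{ib}$, $C^\alpha_{\mu c}=\lambda_i^\alpha\dot\partial_c\lambda_{i\mu}$, $C^a_{bc}=\lambda_i^a\dot\partial_c\lambda_{ib}$ (the unique $d$-connection making the horizontal and vertical parts of all $\lambda_i$ parallel). Its torsion components are $\Lambda^\alpha_{\mu\nu}=\Gamma^\alpha_{\mu\nu}-\Gamma^\alpha_{\nu\mu}$, $R^a_{\mu\nu}$, $C^\alpha_{\mu c}$, $P^a_{\mu c}=\dot\partial_cN^a_\mu-\Gamma^a_{c\mu}$, $T^a_{bc}=C^a_{bc}-C^a_{cb}$.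 Put $C_\mu=\Lambda^\alpha_{\mu\alpha}$, $C_b=T^a_{ba}$, $C^\mu=g^{\mu\beta}C_\beta$, $C^d=g^{db}C_b$. Dual $d$-connection $\widetilde D$: $\widetilde\Gamma^\alpha_{\mu\nu}=\Gamma^\alpha_{\nu\mu}$, $\widetilde\Gamma^a_{b\mu}=\Gamma^a_{b\mu}$, $\widetilde C^\alpha_{\mu c}=C^\alpha_{\mu c}$, $\widetilde C^a_{bc}=C^a_{cb}$. *)

(* Defs.v *)
From HB Require Import structures.
From mathcomp Require Import all_boot all_order all_algebra.
From mathcomp Require Import all_classical all_reals all_analysis.

Set Implicit Arguments.
Unset Strict Implicit.
Unset Printing Implicit Defensive.

Import Order.TTheory GRing.Theory Num.Theory.
Import numFieldNormedType.Exports.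

Local Open Scope classical_set_scope.
Local Open Scope ring_scope.

(* C^infinity on (a neighbourhood of every point of) A: every iterated
   directional derivative is Frechet differentiable at every point of A. *)
Definition smooth_on (R : realType) (V W : normedModType R) (A : set V)
    (f : V -> W) : Prop :=
  forall (vs : seq V) (x : V), A x ->
    differentiable (foldr (fun (v : V) (h : V -> W) => 'D_v h) f vs) x.

Definition paracompact (T : topologicalType) : Prop :=
  forall U : set (set T), (forall A, U A -> open A) ->
    \bigcup_(A in U) A = setT ->
  exists V : set (set T),
    [/\ forall B, V B -> open B,
        \bigcup_(B in V) B = setT,
        forall B, V B -> exists2 A, U A & B `<=` A
      & forall x : T, exists2 W, nbhs x W &
          finite_set [set B | V B /\ B `&` W !=set0]].

Record chart (R : realType) (n : nat) (T : topologicalType) := Chart {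
  cdom : set T;
  cmap : T -> 'rV[R]_n;
  cinv : 'rV[R]_n -> T;
  cdom_open : open cdom;
  cimg_open : open (cmap @` cdom);
  cmapK : forall t, cdom t -> cinv (cmap t) = t;
  cmap_continuous : {within cdom, continuous cmap};
  cinv_continuous : {within cmap @` cdom, continuous cinv} }.

Record smooth_manifold (R : realType) (n : nat) := SmoothManifold {
  carrier :> topologicalType;
  carrier_hausdorff : hausdorff_space carrier;
  carrier_paracompact : paracompact carrier;
  atlas : Type;
  atlas_chart : atlas -> chart R n carrier;
  atlas_cover : forall t : carrier, exists k, cdom (atlas_chart k) t;
  atlas_smooth : forall k l : atlas,
    smooth_on
      (cmap (atlas_chart k) @`
         (cdom (atlas_chart k) `&` cdom (atlas_chart l)))
      (cmap (atlas_chart l) \o cinv (atlas_chart k)) }.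

(* The induced coordinates (x, y) = (p.1, p.2). *)
Notation tcoord R n := ('rV[R]_n * 'rV[R]_n)%type.

Section TangentBundle.
Context (R : realType) (n : nat).

Local Notation tcoord := (tcoord R n).

Definition scal := tcoord -> R.

(* A vector field near (x, y) is given by its components in the natural frame
   (d/dx, d/dy), that is, by a map tcoord -> tcoord. *)
Definition vfield := tcoord -> tcoord.

Definition partial_x (mu : 'I_n) : vfield := fun _ => (delta_mx 0 mu, 0).

Definition partial_y (a : 'I_n) : vfield := fun _ => (0, delta_mx 0 a).

Definition vf_act (X : vfield) (f : scal) : scal := fun p => 'D_(X p) f p.

(* [X, Y]: the components of [X, Y] are X(Y^A) - Y(X^A). *)
Definition lie_bracket (X Y : vfield) : vfield :=
  fun p => 'D_(X p) Y p - 'D_(Y p) X p.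

Section AdaptedFrame.
(* N a mu = N^a_mu *)
Context (N : 'I_n -> 'I_n -> scal).

Definition delta (mu : 'I_n) : vfield :=
  fun p => partial_x mu p - \sum_a N a mu p *: partial_y a p.

Definition dh (mu : 'I_n) (f : scal) : scal := vf_act (delta mu) f.
Definition dv (a : 'I_n) (f : scal) : scal := vf_act (partial_y a) f.

(* Components in the adapted frame:
   X = hcomp X mu * delta mu + vcomp X a * partial_y a. *)
Definition hcomp (X : vfield) (mu : 'I_n) : scal := fun p => (X p).1 0 mu.
Definition vcomp (X : vfield) (a : 'I_n) : scal :=
  fun p => (X p).2 0 a + \sum_mu N a mu p * (X p).1 0 mu.

(* R^a_{mu nu} *)
Definition nlcurv (a mu nu : 'I_n) : scal :=
  fun p => dh nu (N a mu) p - dh mu (N a nu) p.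

(* Gh A m v = Gamma^A_{m v}, Gv a b v = Gamma^a_{b v}, Ch A m c = C^A_{m c},
   Cv a b c = C^a_{b c}; the last index is the direction of derivation. *)
Record dconnection := DConnection {
  Gh : 'I_n -> 'I_n -> 'I_n -> scal;
  Gv : 'I_n -> 'I_n -> 'I_n -> scal;
  Ch : 'I_n -> 'I_n -> 'I_n -> scal;
  Cv : 'I_n -> 'I_n -> 'I_n -> scal }.

(* D_X Z: the linear connection determined, through linearity in X and the
   Leibniz rule in Z, by the values of its coefficients on the adapted frame. *)
Definition nabla (D : dconnection) (X Z : vfield) : vfield := fun p =>
  \sum_al (vf_act X (hcomp Z al) p
           + \sum_mu \sum_nu Gh D al mu nu p * hcomp Z mu p * hcomp X nu p
           + \sum_mu \sum_c Ch D al mu c p * hcomp Z mu p * vcomp X c p)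
        *: delta al p
  + \sum_a (vf_act X (vcomp Z a) p
            + \sum_b \sum_nu Gv D a b nu p * vcomp Z b p * hcomp X nu p
            + \sum_b \sum_c Cv D a b c p * vcomp Z b p * vcomp X c p)
        *: partial_y a p.

Lemma sum_eq_mul (F : 'I_n -> R) (j : 'I_n) : \sum_i F i * (i == j)%:R = F j.
Proof.
rewrite (bigD1 j) //= eqxx mulr1 big1 ?addr0// => i /negPf iN.
by rewrite iN mulr0.
Qed.

Lemma hcomp_delta mu al p : hcomp (delta mu) al p = (al == mu)%:R.
Proof.
rewrite /hcomp /delta /= (raddf_sum (@fst _ _)) /= big1 => [|a _].
  by rewrite subr0 mxE eqxx.
by rewrite scaler0.
Qed.

Lemma vcomp_delta mu a p : vcomp (delta mu) a p = 0.
Proof.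
have E b : (delta mu p).1 0 b = (b == mu)%:R by rewrite -(hcomp_delta mu b p).
rewrite /vcomp; under eq_bigr do rewrite E.
rewrite sum_eq_mul /delta /= (raddf_sum (@snd _ _)) /= sub0r mxE summxE.
under eq_bigr do rewrite !mxE eqxx /= eq_sym.
by rewrite sum_eq_mul addNr.
Qed.

Lemma hcomp_partial_y a al p : hcomp (partial_y a) al p = 0.
Proof. by rewrite /hcomp mxE. Qed.

Lemma vcomp_partial_y b a p : vcomp (partial_y b) a p = (a == b)%:R.
Proof.
rewrite /vcomp /= mxE eqxx big1 ?addr0// => mu _; by rewrite mxE mulr0.
Qed.

Let frameE := (hcomp_delta, vcomp_delta, hcomp_partial_y, vcomp_partial_y).

Let fcst X (f : scal) (c : R) : f = cst c -> vf_act X f = cst 0.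
Proof. by move=> ->; apply/funext => p; rewrite /vf_act derive_cst. Qed.

Lemma nabla_delta_delta D nu mu p :
  nabla D (delta nu) (delta mu) p = \sum_al Gh D al mu nu p *: delta al p.
Proof.
rewrite /nabla [X in _ + X]big1 ?addr0 => [|a _].
  apply: eq_bigr => al _; congr (_ *: _).
  rewrite (@fcst _ _ (al == mu)%:R); last by apply/funext => q; rewrite frameE.
  rewrite add0r [X in _ + X]big1 ?addr0 => [|e _]; last first.
    by rewrite big1 // => c _; rewrite !frameE mulr0.
  under eq_bigr do under eq_bigr do rewrite !frameE.
  under eq_bigr do rewrite sum_eq_mul.
  exact: sum_eq_mul.
rewrite (@fcst _ _ 0); last by apply/funext => q; rewrite frameE.
rewrite add0r !big1 ?addr0 ?scale0r// => b _; rewrite big1 // => c _;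
  by rewrite !frameE mulr0 ?mul0r.
Qed.

Lemma nabla_delta_partial_y D nu b p :
  nabla D (delta nu) (partial_y b) p = \sum_a Gv D a b nu p *: partial_y a p.
Proof.
rewrite /nabla [X in X + _]big1 ?add0r => [|a _].
  apply: eq_bigr => al _; congr (_ *: _).
  rewrite (@fcst _ _ (al == b)%:R); last by apply/funext => q; rewrite frameE.
  rewrite add0r [X in _ + X]big1 ?addr0 => [|e _]; last first.
    by rewrite big1 // => c _; rewrite !frameE mulr0.
  under eq_bigr do under eq_bigr do rewrite !frameE.
  under eq_bigr do rewrite sum_eq_mul.
  exact: sum_eq_mul.
rewrite (@fcst _ _ 0); last by apply/funext => q; rewrite frameE.
rewrite add0r !big1 ?addr0 ?scale0r// => e _; rewrite big1 // => c _;
  by rewrite !frameE mulr0 ?mul0r.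
Qed.

Lemma nabla_partial_y_delta D c mu p :
  nabla D (partial_y c) (delta mu) p = \sum_al Ch D al mu c p *: delta al p.
Proof.
rewrite /nabla [X in _ + X]big1 ?addr0 => [|a _].
  apply: eq_bigr => al _; congr (_ *: _).
  rewrite (@fcst _ _ (al == mu)%:R); last by apply/funext => q; rewrite frameE.
  rewrite add0r [X in X + _]big1 ?add0r => [|e _]; last first.
    by rewrite big1 // => d _; rewrite !frameE mulr0.
  under eq_bigr do under eq_bigr do rewrite !frameE.
  under eq_bigr do rewrite sum_eq_mul.
  exact: sum_eq_mul.
rewrite (@fcst _ _ 0); last by apply/funext => q; rewrite frameE.
rewrite add0r !big1 ?addr0 ?scale0r// => e _; rewrite big1 // => d _;
  by rewrite !frameE mulr0 ?mul0r.
Qed.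

Lemma nabla_partial_y_partial_y D c b p :
  nabla D (partial_y c) (partial_y b) p = \sum_a Cv D a b c p *: partial_y a p.
Proof.
rewrite /nabla [X in X + _]big1 ?add0r => [|a _].
  apply: eq_bigr => al _; congr (_ *: _).
  rewrite (@fcst _ _ (al == b)%:R); last by apply/funext => q; rewrite frameE.
  rewrite add0r [X in X + _]big1 ?add0r => [|e _]; last first.
    by rewrite big1 // => d _; rewrite !frameE mulr0.
  under eq_bigr do under eq_bigr do rewrite !frameE.
  under eq_bigr do rewrite sum_eq_mul.
  exact: sum_eq_mul.
rewrite (@fcst _ _ 0); last by apply/funext => q; rewrite frameE.
rewrite add0r !big1 ?addr0 ?scale0r// => e _; rewrite big1 // => d _;
  by rewrite !frameE mulr0 ?mul0r.
Qed.

Definition curvature (D : dconnection) (X Y Z : vfield) : vfield := fun p =>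
  nabla D X (nabla D Y Z) p - nabla D Y (nabla D X Z) p
  - nabla D (lie_bracket X Y) Z p.

(* R^al_{be mu nu}, R^a_{b mu nu}, P^al_{be nu c}, P^a_{b nu c},
   S^al_{be b c}, S^a_{b c d} *)
Definition curvRh D (al be mu nu : 'I_n) : scal :=
  hcomp (curvature D (delta mu) (delta nu) (delta be)) al.
Definition curvRv D (a b mu nu : 'I_n) : scal :=
  vcomp (curvature D (delta mu) (delta nu) (partial_y b)) a.
Definition curvPh D (al be nu c : 'I_n) : scal :=
  hcomp (curvature D (partial_y c) (delta nu) (delta be)) al.
Definition curvPv D (a b nu c : 'I_n) : scal :=
  vcomp (curvature D (partial_y c) (delta nu) (partial_y b)) a.
Definition curvSh D (al be b c : 'I_n) : scal :=
  hcomp (curvature D (partial_y b) (partial_y c) (delta be)) al.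
Definition curvSv D (a b c d : 'I_n) : scal :=
  vcomp (curvature D (partial_y c) (partial_y d) (partial_y b)) a.

End AdaptedFrame.

(* Covariant derivatives of tensors of type (1,2), (1,0), (0,1) all of whose
   indices are of one kind. The h-derivative is obtained with d := dh N and
   G := Gh D (horizontal indices) or Gv D (vertical indices), the v-derivative
   with d := dv and G := Ch D or Cv D. *)
Section CovariantDerivative.
Context (d : 'I_n -> scal -> scal) (G : 'I_n -> 'I_n -> 'I_n -> scal).

Definition cov12 (T : 'I_n -> 'I_n -> 'I_n -> scal) (i j k m : 'I_n) : scal :=
  fun p => d m (T i j k) p + \sum_e T e j k p * G i e m p
           - \sum_e T i e k p * G e j m p - \sum_e T i j e p * G e k m p.

Definition cov10 (T : 'I_n -> scal) (i m : 'I_n) : scal :=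
  fun p => d m (T i) p + \sum_e T e p * G i e m p.

Definition cov01 (T : 'I_n -> scal) (j m : 'I_n) : scal :=
  fun p => d m (T j) p - \sum_e T e p * G e j m p.

End CovariantDerivative.

Definition dual_dconn (D : dconnection) : dconnection :=
  DConnection (fun al mu nu => Gh D al nu mu) (Gv D)
              (Ch D) (fun a b c => Cv D a c b).

Section Parallelization.
Context (N : 'I_n -> 'I_n -> scal) (lam : 'I_n -> vfield).

Definition lamh_mx (p : tcoord) : 'M[R]_n := \matrix_(i, al) hcomp (lam i) al p.
Definition lamv_mx (p : tcoord) : 'M[R]_n :=
  \matrix_(i, a) vcomp N (lam i) a p.

(* lambda_{i al} and lambda_{i a}; the transposition comes from
   lambda_{i al} lambda_i^be = delta_al^be. *)
Definition colamh (i al : 'I_n) : scal := fun p => invmx (lamh_mx p) al i.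
Definition colamv (i a : 'I_n) : scal := fun p => invmx (lamv_mx p) a i.

Definition gh_mx (p : tcoord) : 'M[R]_n :=
  \matrix_(al, be) \sum_i colamh i al p * colamh i be p.
Definition gv_mx (p : tcoord) : 'M[R]_n :=
  \matrix_(a, b) \sum_i colamv i a p * colamv i b p.

(* g^{al be} and g^{a b} *)
Definition ginvh (al be : 'I_n) : scal := fun p => invmx (gh_mx p) al be.
Definition ginvv (a b : 'I_n) : scal := fun p => invmx (gv_mx p) a b.

Definition canonical_dconn : dconnection := DConnection
  (fun al mu nu p => \sum_i hcomp (lam i) al p * dh N nu (colamh i mu) p)
  (fun a b nu p => \sum_i vcomp N (lam i) a p * dh N nu (colamv i b) p)
  (fun al mu c p => \sum_i hcomp (lam i) al p * dv c (colamh i mu) p)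
  (fun a b c p => \sum_i vcomp N (lam i) a p * dv c (colamv i b) p).

(* Lambda^al_{mu nu}, P^a_{mu c}, T^a_{b c} *)
Definition torsh (al mu nu : 'I_n) : scal :=
  fun p => Gh canonical_dconn al mu nu p - Gh canonical_dconn al nu mu p.
Definition torsP (a mu c : 'I_n) : scal :=
  fun p => dv c (N a mu) p - Gv canonical_dconn a c mu p.
Definition torsv (a b c : 'I_n) : scal :=
  fun p => Cv canonical_dconn a b c p - Cv canonical_dconn a c b p.

(* C_mu, C_b, C^mu, C^d *)
Definition contrh (mu : 'I_n) : scal := fun p => \sum_al torsh al mu al p.
Definition contrv (b : 'I_n) : scal := fun p => \sum_a torsv a b a p.
Definition contrh_up (mu : 'I_n) : scal :=
  fun p => \sum_be ginvh mu be p * contrh be p.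
Definition contrv_up (d : 'I_n) : scal :=
  fun p => \sum_b ginvv d b p * contrv b p.

End Parallelization.

Context (M : smooth_manifold R n).

Definition trans (k l : atlas M) : 'rV[R]_n -> 'rV[R]_n :=
  cmap (atlas_chart l) \o cinv (atlas_chart k).

(* Transition map of TM between induced charts. *)
Definition ttrans (k l : atlas M) : tcoord -> tcoord :=
  fun p => (trans k l p.1, 'D_(p.2) (trans k l) p.1).

Definition tdom (k : atlas M) : set tcoord :=
  [set p | (cmap (atlas_chart k) @` cdom (atlas_chart k)) p.1].

Definition toverlap (k l : atlas M) : set tcoord :=
  [set p | (cmap (atlas_chart k) @`
             (cdom (atlas_chart k) `&` cdom (atlas_chart l))) p.1].

(* Vector fields on TM, as compatible families of local representatives. *)
Record tm_vector_field := TMVectorField {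
  vf_rep :> atlas M -> vfield;
  vf_smooth : forall k, smooth_on (tdom k) (vf_rep k);
  vf_compat : forall k l p, toverlap k l p ->
    vf_rep l (ttrans k l p) = 'D_(vf_rep k p) (ttrans k l) p }.

(* The compatibility condition says that the horizontal distributions spanned
   by the delta_mu agree: delta_nu = (dx'^mu / dx^nu) delta'_mu. *)
Record nonlinear_connection := NonlinearConnection {
  nl_rep :> atlas M -> 'I_n -> 'I_n -> scal;
  nl_smooth : forall k a mu, smooth_on (tdom k) (nl_rep k a mu);
  nl_compat : forall k l nu p, toverlap k l p ->
    'D_(delta (nl_rep k) nu p) (ttrans k l) p =
    \sum_mu ('D_(delta_mx 0 nu) (trans k l) p.1) 0 mu
              *: delta (nl_rep l) mu (ttrans k l p) }.

Record EAP_space := EAPSpace {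
  nlc : nonlinear_connection;
  lambda : 'I_n -> tm_vector_field;
  lambda_hfree : forall k p, tdom k p ->
    row_free (lamh_mx (fun i => lambda i k) p);
  lambda_vfree : forall k p, tdom k p ->
    row_free (lamv_mx (nlc k) (fun i => lambda i k) p) }.

End TangentBundle.

Arguments dv {R n} a f p.

(* Main.v *)
Require Import Defs.
From HB Require Import structures.
From mathcomp Require Import all_boot all_order all_algebra.
From mathcomp Require Import all_classical all_reals all_analysis.
From mathcomp Require Import ring lra.
Set Implicit Arguments.
Unset Strict Implicit.
Unset Printing Implicit Defensive.
Import Order.TTheory GRing.Theory Num.Theory.
Import numFieldNormedType.Exports.
Local Open Scope ring_scope.

(* The canonical coefficients are omega^a_b(X) = A_i^a X(B_ib) for a frame A
   with coframe B, so that the canonical d-connection is flat: by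
   X(B_ib) = B_ia omega^a_b(X), the commutator [X, Y] evaluated on the coframe
   gives X omega(Y) - Y omega(X) + [omega(X), omega(Y)] = omega([X, Y]) for all
   X, Y.  The dual connection has the same coefficients up to a transposition
   of indices, so each of its curvature components is a combination of at most
   two flatness identities plus terms linear in the torsion, and these assemble
   into the covariant derivatives of the torsion.  The contracted formulas use
   in addition that the metric, being built from parallel frames, is parallel.

   The commutator identity rests on the symmetry of second derivatives, which
   holds as soon as the function is differentiable near the point and its
   directional derivatives are differentiable at the point. *)

(** * Symmetry of second directional derivatives *)

Section SecondDerivatives.
Context (R : realType) (V : normedModType R).

(** A first-order expansion of [f] at [p] only sees the germ of [f], so it is also one of [g], and
    [diff_unique] identifies its linear part with the differential of [g]. *)
Lemma near_eq_differentiable (W : normedModType R) (f g : V -> W) (p : V) :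
  (\near p, f p = g p) -> differentiable f p -> differentiable g p.
Proof.
move=> fg df; have [cdf fE] := (diff_locallyP p f).1 df.
suff gE : g \o shift p = cst (g p) + 'd f p +o_ 0 id.
  by apply/diff_locallyP; rewrite (diff_unique cdf gE).
apply/eqaddoP => e e0; move/eqaddoP/(_ e e0): fE.
apply: filterS2; last first.
  move: fg; rewrite (near_shift 0 p) /= => fg; exact: fg.
move=> h /=; rewrite subr0 => fgh.
by rewrite !fctE /= -(nbhs_singleton fg) fgh.
Qed.

Lemma derive_linear (W : normedModType R) (f : V -> W) (p : V) (a : R)
    (u v : V) : differentiable f p ->
  'D_(a *: u + v) f p = a *: 'D_u f p + 'D_v f p.
Proof. by move=> df; rewrite !deriveE// linearP. Qed.

(** The difference quotients along the line are those of the directional derivative, which makes the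
    one-variable mean value theorem available. *)
Lemma is_derive_line (f : V -> R) (u w : V) (t : R) :
  differentiable f (t *: u + w) ->
  is_derive t 1 (fun s => f (s *: u + w)) ('D_u f (t *: u + w)).
Proof.
move=> df.
have E : (fun h : R => h^-1 *:
      (((fun s => f (s *: u + w)) \o shift t) (h *: 1) - f (t *: u + w))) =
    (fun h : R => h^-1 *:
      ((f \o shift (t *: u + w)) (h *: u) - f (t *: u + w))).
  apply/funext => h /=; congr (_ *: (f _ - _)).
  by rewrite scalerDl addrA -[h *: 1]/(h * 1) mulr1.
have dfu : derivable f (t *: u + w) u by exact: diff_derivable.
by split; rewrite /derivable /derive E.
Qed.

Lemma differentiable_remainder (f : V -> R) (p : V) (e : R) :
  differentiable f p -> 0 < e ->
  exists2 r : R, 0 < r & forall w : V, `|w| < r ->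
    `|f (w + p) - f p - 'D_w f p| <= e * `|w|.
Proof.
move=> df e0; have [_ fE] := (diff_locallyP p f).1 df.
move/eqaddoP/(_ e e0): fE => /nbhs_ballP [r r0 rP].
exists r => // w wr; have := rP w.
rewrite -ball_normE /ball_ /= sub0r normrN => /(_ wr).
by rewrite !fctE /= opprD addrA deriveE.
Qed.

(** The second difference is the increment over [[0, h]] of [t |-> f (t u + h v + p) - f (t u + p)].
    The mean value theorem turns it into [h] times a difference of values of [g] near [p], and the
    first-order expansion of [g] at [p] evaluates that difference as [h * 'D_v g p + o(h)]. *)
Lemma second_difference (f g : V -> R) (p u v : V) (e : R) :
  'D_u f = g -> (\forall q \near p, differentiable f q) ->
  differentiable g p ->
  0 < e -> \forall h \near at_right (0 : R),
    `|f (h *: u + h *: v + p) - f (h *: u + p) - f (h *: v + p) + f p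
      - h * (h * 'D_v g p)| <= e * (h * h).
Proof.
move=> gE /nbhs_ballP[r r0 rP] dg e0.
(* [K] collects the two remainders, taken at displacements of norm at most [h (|u| + |v|)] and
   [h |u|]; the added [1] keeps it positive when [u] and [v] vanish. *)
set K := `|u| + `|v| + `|u| + 1.
have K0 : 0 < K by rewrite /K ltr_pwDr// !addr_ge0.
have eK : 0 < e / K by rewrite divr_gt0.
have [s s0 sP] := differentiable_remainder dg eK.
have m0 : 0 < Num.min r s / K by rewrite divr_gt0// lt_min r0 s0.
near=> h.
have h0 : 0 < h by near: h; exact: nbhs_right_gt.
have hm : h * K < Num.min r s.
  by rewrite -ltr_pdivlMr//; near: h; exact: nbhs_right_lt.
have small (c : R) (b : bool) : 0 <= c <= h ->
    `|c *: u + (b%:R * h) *: v| <= h * (`|u| + `|v|).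
  move=> /andP[c0 ch]; rewrite (le_trans (ler_normD _ _))// !normrZ mulrDr.
  apply: lerD; first by rewrite ler_wpM2r// ger0_norm.
  rewrite ler_wpM2r// normr_nat (gtr0_norm h0).
  by case: b; rewrite ?mul1r ?mul0r ?lexx// ltW.
have hK : h * (`|u| + `|v|) < Num.min r s.
  apply: le_lt_trans hm; rewrite ler_wpM2l ?(ltW h0)// /K -addrA lerDl.
  by rewrite addr_ge0.
(* The boolean switches the displacement [h v] on or off, so that both terms of the difference obey
   the same estimates. *)
pose phi b (t : R) := f (t *: u + ((b%:R * h) *: v + p)).
have dphi (b : bool) (c : R) : 0 <= c <= h ->
    is_derive c 1 (phi b) (g (c *: u + ((b%:R * h) *: v + p))).
  move=> ch; rewrite -gE; apply: is_derive_line; apply: rP.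
  rewrite -ball_normE /ball_ /= -normrN opprB addrA addrK.
  by rewrite (le_lt_trans (small c b ch))// (lt_le_trans hK)// ge_min lexx.
pose dp c := g (c *: u + ((true%:R * h) *: v + p))
             - g (c *: u + ((false%:R * h) *: v + p)).
have dphi2 (c : R) : 0 <= c <= h -> is_derive c 1 (phi true - phi false) (dp c).
  by move=> ch; apply: is_deriveB; exact: dphi.
have [c ch E] : exists2 c, 0 <= c <= h &
    (phi true - phi false) h - (phi true - phi false) 0 = dp c * h.
  have := @MVT_segment R (phi true - phi false) dp 0 h (ltW h0).
  rewrite subr0; case => [x||c].
  - rewrite in_itv /= => /andP[x0 xh]; by apply: dphi2; rewrite !ltW.
  - apply: derivable_within_continuous => x; rewrite in_itv /= => xh.
    exact: (@ex_derive _ _ _ _ _ _ _ (dphi2 x xh)).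
  - by rewrite in_itv /= => ch; exists c.
have -> : f (h *: u + h *: v + p) - f (h *: u + p) - f (h *: v + p) + f p
    = dp c * h.
  rewrite -E /phi !fctE /= !mul1r !mul0r !scale0r !add0r addrA; ring.
(* The common direction [c u] drops out, so the unknown intermediate point [c] leaves the main
   term. *)
have Dv : 'D_(c *: u + (true%:R * h) *: v) g p
    - 'D_(c *: u + (false%:R * h) *: v) g p = h * 'D_v g p.
  rewrite !(derive_linear c)// mul1r mul0r scale0r derive0 addr0 addrC addKr.
  by rewrite -[h *: v]addr0 derive_linear// derive0 addr0.
have B (b : bool) : `|g (c *: u + (b%:R * h) *: v + p) - g p
            - 'D_(c *: u + (b%:R * h) *: v) g p|
       <= e / K * `|c *: u + (b%:R * h) *: v|.
  apply: sP; rewrite (le_lt_trans (small c b ch))// (lt_le_trans hK)//.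
  by rewrite ge_min lexx orbT.
have -> : dp c * h - h * (h * 'D_v g p) =
   ((g (c *: u + (true%:R * h) *: v + p) - g p
            - 'D_(c *: u + (true%:R * h) *: v) g p)
   - (g (c *: u + (false%:R * h) *: v + p) - g p
            - 'D_(c *: u + (false%:R * h) *: v) g p)) * h.
  have ringE (x y a b z : R) :
    (x - y) * h - h * (a - b) = (x - z - a - (y - z - b)) * h by ring.
  by rewrite -Dv /dp !addrA; exact: ringE.
rewrite normrM [`|h|]gtr0_norm// [e * _]mulrA ler_pM2r//.
apply: le_trans (ler_normB _ _) _; apply: le_trans (lerD (B true) (B false)) _.
rewrite -mulrDr -mulrA ler_pM2l// ler_pdivrMl//.
apply: (@le_trans _ _ (h * (`|u| + `|v|) + h * `|u|)).
  rewrite lerD ?small// mul0r scale0r addr0 normrZ.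
  by case/andP: ch => c0 ch; rewrite ger0_norm// ler_wpM2r.
by rewrite -mulrDr mulrC ler_wpM2r ?(ltW h0)// /K lerDl.
Unshelve. all: by end_near. Qed.

(** The second difference is symmetric in [u] and [v], and [second_difference] compares it with
    [h * h] times either mixed derivative, at a cost of [e / 2] each. *)
Lemma schwarz (f : V -> R) (p u v : V) :
  (\forall q \near p, differentiable f q) ->
  differentiable ('D_u f) p -> differentiable ('D_v f) p ->
  'D_u ('D_v f) p = 'D_v ('D_u f) p.
Proof.
move=> df du dv; apply/eqP; rewrite -subr_eq0 -normr_le0.
apply/ler_addgt0Pr => e e0; rewrite add0r.
have e2 : 0 < e / 2 by rewrite divr_gt0.
have Fu := second_difference v erefl df du e2.
have Fv := second_difference u erefl df dv e2.
near (at_right (0 : R)) => h.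
have h0 : 0 < h by near: h; exact: nbhs_right_gt.
have hu := near Fu h; have hv := near Fv h.
have hh : 0 < h * h by rewrite mulr_gt0.
rewrite -(ler_pM2r hh) -[h * h in X in X <= _]gtr0_norm// -normrM.

have -> : ('D_u ('D_v f) p - 'D_v ('D_u f) p) * (h * h) =
  (f (h *: u + h *: v + p) - f (h *: u + p) - f (h *: v + p) + f p
      - h * (h * 'D_v ('D_u f) p)) -
  (f (h *: v + h *: u + p) - f (h *: v + p) - f (h *: u + p) + f p
      - h * (h * 'D_u ('D_v f) p)).
  have ringE (x y a b c d : R) : (a - b) * (h * h) =
    (x - y - c + d - h * (h * b)) - (x - c - y + d - h * (h * a)) by ring.
  by rewrite [h *: v + h *: u]addrC; exact: ringE.
apply: le_trans (ler_normB _ _) _.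
rewrite [e]splitr mulrDl lerD//; [exact: hu|exact: hv].
Unshelve. all: by end_near. Qed.

End SecondDerivatives.

(** The hypotheses of [schwarz] for all directions at once. The second condition is imposed at [p]
    only, which is enough for closure under sums, products, inverses and continuous linear maps. *)
Definition twice_differentiable (R : realType) (V W : normedModType R)
    (f : V -> W) (p : V) : Prop :=
  (\forall q \near p, differentiable f q) /\
  (forall v, differentiable ('D_v f) p).

(** * Differentiation rules for pointwise combinations and matrix inverses *)

Section Calculus.
Context (R : realType) (V : normedModType R).
Implicit Types (f g : V -> R) (p v : V) (I : finType).

Lemma differentiable_fun_add f g p :
  differentiable f p -> differentiable g p ->
  differentiable (fun q => f q + g q) p.
Proof. exact: differentiableD. Qed.

Lemma differentiable_fun_sub f g p :
  differentiable f p -> differentiable g p ->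
  differentiable (fun q => f q - g q) p.
Proof. exact: differentiableB. Qed.

Lemma differentiable_fun_mul f g p :
  differentiable f p -> differentiable g p ->
  differentiable (fun q => f q * g q) p.
Proof. exact: differentiableM. Qed.

Lemma differentiable_fun_sum I (F : I -> V -> R) p :
  (forall i, differentiable (F i) p) ->
  differentiable (fun q => \sum_i F i q) p.
Proof.
move=> dF; elim: (index_enum I) => [|i s IHs].
  have -> : (fun q => \sum_(i <- [::]) F i q) = cst 0.
    by apply/funext => q; rewrite big_nil.
  exact: differentiable_cst.
have -> : (fun q => \sum_(j <- i :: s) F j q) =
    (fun q => F i q + \sum_(j <- s) F j q).
  by apply/funext => q; rewrite big_cons.
exact: differentiable_fun_add.
Qed.

Lemma derive_fun_add f g p v :
  differentiable f p -> differentiable g p ->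
  'D_v (fun q => f q + g q) p = 'D_v f p + 'D_v g p.
Proof. by move=> df dg; apply: deriveD; exact: diff_derivable. Qed.

Lemma derive_fun_sub f g p v :
  differentiable f p -> differentiable g p ->
  'D_v (fun q => f q - g q) p = 'D_v f p - 'D_v g p.
Proof. by move=> df dg; apply: deriveB; exact: diff_derivable. Qed.

Lemma derive_fun_mul f g p v :
  differentiable f p -> differentiable g p ->
  'D_v (fun q => f q * g q) p = f p * 'D_v g p + g p * 'D_v f p.
Proof. by move=> df dg; apply: deriveM; exact: diff_derivable. Qed.

Lemma derive_fun_sum I (F : I -> V -> R) p v :
  (forall i, differentiable (F i) p) ->
  'D_v (fun q => \sum_i F i q) p = \sum_i 'D_v (F i) p.
Proof.
move=> dF.
(* Differentiability of the partial sums is carried along because the sum rule needs it at each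
   step. *)
suff H s : differentiable (fun q => \sum_(i <- s) F i q) p /\
  'D_v (fun q => \sum_(i <- s) F i q) p = \sum_(i <- s) 'D_v (F i) p.
  by have [] := H (index_enum I).
elim: s => [|i s [ds IHs]].
  have -> : (fun q => \sum_(i <- [::]) F i q) = cst 0.
    by apply/funext => q; rewrite big_nil.
  by rewrite big_nil derive_cst; split => //; exact: differentiable_cst.
have -> : (fun q => \sum_(j <- i :: s) F j q) =
    (fun q => F i q + \sum_(j <- s) F j q).
  by apply/funext => q; rewrite big_cons.
split; first exact: differentiable_fun_add.
by rewrite derive_fun_add// IHs big_cons.
Qed.

Lemma derive_lincomb I (c : I -> R) (u : I -> V) f p :
  differentiable f p ->
  'D_(\sum_i c i *: u i) f p = \sum_i c i * 'D_(u i) f p.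
Proof.
move=> df; elim/big_rec2: _ => [|i x w _ <-]; first exact: derive0.
exact: derive_linear.
Qed.

Section ContinuousLinear.
Context (W : normedModType R) (L : {linear W -> R}).
Hypothesis cL : continuous L.

Lemma differentiable_lin (F : V -> W) p :
  differentiable F p -> differentiable (fun q => L (F q)) p.
Proof.
move=> dF; apply: (@differentiable_comp _ _ _ _ F L) => //.
exact: linear_differentiable.
Qed.

Lemma derive_lin (F : V -> W) p v : differentiable F p ->
  'D_v (fun q => L (F q)) p = L ('D_v F p).
Proof.
move=> dF; have dL : differentiable L (F p) by exact: linear_differentiable.
rewrite !deriveE//; last exact: differentiable_lin.
by rewrite (@diff_comp _ _ _ _ F L)// diff_lin.
Qed.

Lemma twice_differentiable_lin (F : V -> W) p :
  twice_differentiable F p -> twice_differentiable (fun q => L (F q)) p.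
Proof.
move=> [dF d2F]; split.
  by apply: filterS dF => q; exact: differentiable_lin.
move=> v; apply: near_eq_differentiable (differentiable_lin (d2F v)).
by apply: filterS dF => q dFq; rewrite derive_lin.
Qed.

End ContinuousLinear.

Lemma smooth_on_twice_differentiable (W : normedModType R) (A : set V)
    (F : V -> W) p : open A -> A p -> smooth_on A F -> twice_differentiable F p.
Proof.
move=> oA Ap sF; split; last by move=> v; exact: (sF [:: v] p Ap).
by apply: filterS (open_nbhs_nbhs (conj oA Ap)) => q; exact: (sF [::]).
Qed.

Lemma twice_differentiable_diff (W : normedModType R) (F : V -> W) p :
  twice_differentiable F p -> differentiable F p.
Proof. by move=> [dF _]; exact: nbhs_singleton dF. Qed.

Lemma near_eq_twice_differentiable f g p : (\near p, f p = g p) ->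
  twice_differentiable f p -> twice_differentiable g p.
Proof.
(* [nbhs_interior] makes the two functions agree near every point close to [p], so that their
   directional derivatives agree near [p] too. *)
move=> fg [df d2f]; have fg2 := nbhs_interior fg; split.
  by apply: filterS2 fg2 df => q fgq; exact: near_eq_differentiable.
move=> v; apply: near_eq_differentiable (d2f v).
by apply: filterS fg2 => q fgq; exact: near_eq_derive.
Qed.

Lemma twice_differentiable_cst (c : R) p : twice_differentiable (cst c) p.
Proof.
split; first by near=> q; exact: differentiable_cst.
move=> v; have -> : 'D_v (cst c) = cst 0 :> (V -> R).
  by apply/funext => q; exact: derive_cst.
exact: differentiable_cst.
Unshelve. all: by end_near. Qed.

Lemma twice_differentiable_add f g p :
  twice_differentiable f p -> twice_differentiable g p ->
  twice_differentiable (fun q => f q + g q) p.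
Proof.
move=> [df d2f] [dg d2g]; split.
  by apply: filterS2 df dg => q; exact: differentiable_fun_add.
move=> v.
apply: near_eq_differentiable (differentiable_fun_add (d2f v) (d2g v)).
by apply: filterS2 df dg => q dfq dgq; rewrite derive_fun_add.
Qed.

Lemma twice_differentiable_mul f g p :
  twice_differentiable f p -> twice_differentiable g p ->
  twice_differentiable (fun q => f q * g q) p.
Proof.
move=> cf cg; have df1 := twice_differentiable_diff cf.
have dg1 := twice_differentiable_diff cg.
move: cf cg => [df d2f] [dg d2g]; split.
  by apply: filterS2 df dg => q; exact: differentiable_fun_mul.
move=> v; apply: near_eq_differentiable; last first.
  exact: differentiable_fun_add (differentiable_fun_mul df1 (d2g v))
                                (differentiable_fun_mul dg1 (d2f v)).
by apply: filterS2 df dg => q dfq dgq; rewrite derive_fun_mul.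
Qed.

Lemma twice_differentiable_inv f p : f p != 0 ->
  twice_differentiable f p -> twice_differentiable (fun q => (f q)^-1) p.
Proof.
move=> f0 cf; have df1 := twice_differentiable_diff cf.
have f0' : \forall q \near p, f q != 0.
  exact: cvgr_neq0 (differentiable_continuous df1) f0.
move: cf => [df d2f]; split.
  by apply: filterS2 f0' df => q fq dfq; exact: differentiableV.
have dV := differentiableV df1 f0.
(* Where [f] does not vanish, the derivative of the inverse is [- f^-1 * f^-1 * 'D_v f], a product
   of functions differentiable at [p]. *)
move=> v; apply: near_eq_differentiable; last first.
  apply: (@differentiable_fun_mul (fun q => - (f q)^-1 * (f q)^-1));
    last exact: d2f.
  by apply: differentiable_fun_mul => //; exact: differentiableN.
apply: filterS2 f0' df => q fq dfq.
rewrite deriveV//; last exact: diff_derivable.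
by rewrite -[RHS]/(_ * _) expr2 invfM !mulNr.
Qed.

Lemma twice_differentiable_sum I (F : I -> V -> R) p :
  (forall i, twice_differentiable (F i) p) ->
  twice_differentiable (fun q => \sum_i F i q) p.
Proof.
move=> dF; elim: (index_enum I) => [|i s IHs].
  have -> : (fun q => \sum_(i <- [::]) F i q) = cst 0.
    by apply/funext => q; rewrite big_nil.
  exact: twice_differentiable_cst.
have -> : (fun q => \sum_(j <- i :: s) F j q) =
    (fun q => F i q + \sum_(j <- s) F j q).
  by apply/funext => q; rewrite big_cons.
exact: twice_differentiable_add.
Qed.

Lemma twice_differentiable_prod I (F : I -> V -> R) p :
  (forall i, twice_differentiable (F i) p) ->
  twice_differentiable (fun q => \prod_i F i q) p.
Proof.
move=> dF; elim: (index_enum I) => [|i s IHs].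
  have -> : (fun q => \prod_(i <- [::]) F i q) = cst 1.
    by apply/funext => q; rewrite big_nil.
  exact: twice_differentiable_cst.
have -> : (fun q => \prod_(j <- i :: s) F j q) =
    (fun q => F i q * \prod_(j <- s) F j q).
  by apply/funext => q; rewrite big_cons.
exact: twice_differentiable_mul.
Qed.

Lemma twice_differentiable_det m (A : V -> 'M[R]_m) p :
  (forall i j, twice_differentiable (fun q => A q i j) p) ->
  twice_differentiable (fun q => \det (A q)) p.
Proof.
move=> dA; apply: twice_differentiable_sum => s.
apply: twice_differentiable_mul; first exact: twice_differentiable_cst.
by apply: twice_differentiable_prod => i; exact: dA.
Qed.

(** Cramer's rule: near [p] the entries are cofactors divided by the determinant. *)
Lemma twice_differentiable_invmx m (A : V -> 'M[R]_m) p i j :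
  (forall i j, twice_differentiable (fun q => A q i j) p) ->
  (\forall q \near p, A q \in unitmx) ->
  twice_differentiable (fun q => invmx (A q) i j) p.
Proof.
move=> dA uA; apply: (@near_eq_twice_differentiable
    (fun q => (\det (A q))^-1 *
       ((-1) ^+ (j + i) * \det (row' j (col' i (A q)))))).
  by apply: filterS uA => q; rewrite /invmx => ->; rewrite !mxE.
apply: twice_differentiable_mul.
  apply: twice_differentiable_inv; last exact: twice_differentiable_det.
  by rewrite -unitfE -unitmxE; exact: nbhs_singleton uA.
apply: twice_differentiable_mul; first exact: twice_differentiable_cst.
apply: twice_differentiable_det => k l.
have -> : (fun q => row' j (col' i (A q)) k l) =
    (fun q => A q (lift j k) (lift i l)).
  by apply/funext => q; rewrite !mxE.
exact: dA.
Qed.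

End Calculus.

(** * Vector fields as derivations, and their commutator *)

Section CoordinateFields.
Context (R : realType) (n : nat).
Local Notation tcoord := (tcoord R n).
Implicit Types (X Y : vfield R n) (f g : scal R n) (p q : tcoord).

Definition tbasis (j : 'I_n + 'I_n) : tcoord :=
  match j with inl m => (delta_mx 0 m, 0) | inr a => (0, delta_mx 0 a) end.

Definition tcoef (j : 'I_n + 'I_n) (w : tcoord) : R :=
  match j with inl m => w.1 0 m | inr a => w.2 0 a end.

Fact tcoef_is_linear j : linear (tcoef j).
Proof. by case: j => j a u v; rewrite /= !mxE. Qed.

HB.instance Definition _ j :=
  GRing.isLinear.Build R tcoord R *%R (tcoef j) (tcoef_is_linear j).

Lemma tcoef_continuous j : continuous (tcoef j).
Proof.
case: j => j w.
  apply: (@continuous_comp _ _ _ fst (fun u : 'rV[R]_n => u 0 j)).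
    exact: cvg_fst.
  exact: coord_continuous.
apply: (@continuous_comp _ _ _ snd (fun u : 'rV[R]_n => u 0 j)).
  exact: cvg_snd.
exact: coord_continuous.
Qed.

Lemma tbasis_decomp (w : tcoord) : w = \sum_j tcoef j w *: tbasis j.
Proof.
rewrite big_sumType /=; case: w => x y /=.
have E (u : 'rV[R]_n) : u = \sum_m u 0 m *: delta_mx 0 m.
  apply/rowP => j; rewrite summxE (bigD1 j)//= big1 => [|i ij].
    by rewrite !mxE !eqxx mulr1 addr0.
  by rewrite !mxE eqxx /= eq_sym (negbTE ij) mulr0.
rewrite [LHS](_ : _ = (x, 0) + (0, y)); last first.
  by congr pair; rewrite /= ?addr0 ?add0r.
congr (_ + _).
  rewrite [X in (X, _)]E; elim/big_rec2: _ => // i u v _ <-.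
  by congr pair; rewrite /= ?scaler0 ?addr0.
rewrite [X in (_, X)]E; elim/big_rec2: _ => // i u v _ <-.
by congr pair; rewrite /= ?scaler0 ?addr0.
Qed.

Lemma derive_tbasis f p w : differentiable f p ->
  'D_w f p = \sum_j tcoef j w * 'D_(tbasis j) f p.
Proof. by move=> df; rewrite [in LHS](tbasis_decomp w) derive_lincomb. Qed.

(** The direction of derivation varies with the point; expanding it in the constant frame [tbasis]
    reduces the claim to a finite sum of products. *)
Lemma differentiable_vf_act Y f p : differentiable Y p ->
  twice_differentiable f p -> differentiable (vf_act Y f) p.
Proof.
move=> dY [df d2f].
apply: (@near_eq_differentiable _ _ _
    (fun q => \sum_j tcoef j (Y q) * 'D_(tbasis j) f q)).
  by apply: filterS df => q dfq; rewrite -derive_tbasis.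
apply: differentiable_fun_sum => j; apply: differentiable_fun_mul => //.
exact: differentiable_lin (@tcoef_continuous j) _ _ dY.
Qed.

(** Leibniz rule in the direction field: the first term differentiates [Y], the second keeps the
    direction frozen at [Y p]. *)
Lemma derive_vf_act Y f p u : differentiable Y p ->
  twice_differentiable f p ->
  'D_u (vf_act Y f) p = 'D_('D_u Y p) f p + 'D_u ('D_(Y p) f) p.
Proof.
move=> dY cf; have df1 := twice_differentiable_diff cf; move: cf => [df d2f].
have dc j : differentiable (fun q => tcoef j (Y q)) p.
  exact: differentiable_lin (@tcoef_continuous j) _ _ dY.
have E1 : 'D_u (vf_act Y f) p =
    'D_u (fun q => \sum_j tcoef j (Y q) * 'D_(tbasis j) f q) p.
  apply: near_eq_derive; apply: filterS df => q dfq.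
  exact: derive_tbasis.
have E2 : 'D_u ('D_(Y p) f) p =
    'D_u (fun q => \sum_j cst (tcoef j (Y p)) q * 'D_(tbasis j) f q) p.
  apply: near_eq_derive; apply: filterS df => q dfq.
  exact: derive_tbasis.
rewrite [LHS]E1 [X in _ = _ + X]E2.
rewrite !derive_fun_sum; last 2 first.
- by move=> j; apply: differentiable_fun_mul => //; exact: differentiable_cst.
- by move=> j; exact: differentiable_fun_mul.
rewrite (derive_tbasis _ df1) -big_split; apply: eq_bigr => j _ /=.
have dk : differentiable (cst (tcoef j (Y p)) : tcoord -> R) p.
  exact: differentiable_cst.
rewrite (derive_fun_mul _ dk (d2f _)) (derive_fun_mul _ (dc j) (d2f _)).
rewrite derive_cst mulr0 addr0.
rewrite (derive_lin (@tcoef_continuous j))// addrC; congr (_ + _).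
exact: mulrC.
Qed.

(** The second-order terms with frozen directions cancel by [schwarz]; the remaining first-order
    terms are derivatives of [f] along ['D_(X p) Y p] and ['D_(Y p) X p]. *)
Lemma vf_act_commutator X Y f p : differentiable X p -> differentiable Y p ->
  twice_differentiable f p ->
  vf_act X (vf_act Y f) p - vf_act Y (vf_act X f) p =
  vf_act (lie_bracket X Y) f p.
Proof.
move=> dX dY cf; have df1 := twice_differentiable_diff cf.
have EY := derive_vf_act (X p) dY cf; have EX := derive_vf_act (Y p) dX cf.
case: cf => df d2f; have S := schwarz df (d2f (X p)) (d2f (Y p)).
have L := derive_linear (-1) ('D_(Y p) X p) ('D_(X p) Y p) df1.
have cancel (a b c d : R) : b = d -> (a + b) - (c + d) = -1 *: c + a.
  by move=> ->; rewrite scaleN1r opprD addrACA subrr addr0 addrC.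
have bracketE : lie_bracket X Y p = -1 *: 'D_(Y p) X p + 'D_(X p) Y p.
  by rewrite /lie_bracket scaleN1r addrC.
rewrite [X in X - _]EY [X in _ - X]EX (cancel _ _ _ _ S).
by rewrite [RHS]/vf_act bracketE; exact: esym L.
Qed.

End CoordinateFields.

(** * Derivation rules for [vf_act] *)

Section VectorFieldDerivations.
Context (R : realType) (n : nat).
Implicit Types (X : vfield R n) (f g : scal R n) (p : tcoord R n) (I : finType).

Lemma vf_act_sub X f g p : differentiable f p -> differentiable g p ->
  vf_act X (fun q => f q - g q) p = vf_act X f p - vf_act X g p.
Proof. exact: derive_fun_sub. Qed.

Lemma vf_act_mul X f g p : differentiable f p -> differentiable g p ->
  vf_act X (fun q => f q * g q) p = f p * vf_act X g p + g p * vf_act X f p.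
Proof. exact: derive_fun_mul. Qed.

Lemma vf_act_sum X I (F : I -> scal R n) p :
  (forall i, differentiable (F i) p) ->
  vf_act X (fun q => \sum_i F i q) p = \sum_i vf_act X (F i) p.
Proof. exact: derive_fun_sum. Qed.

Lemma vf_act_cst X (c : R) p : vf_act X (fun=> c) p = 0.
Proof. exact: derive_cst. Qed.

Lemma near_eq_vf_act X f g p :
  (\near p, f p = g p) -> vf_act X f p = vf_act X g p.
Proof. exact: near_eq_derive. Qed.

Lemma vf_act_lincomb X I (c : I -> R) (Y : I -> vfield R n) f p :
  differentiable f p -> X p = \sum_i c i *: Y i p ->
  vf_act X f p = \sum_i c i * vf_act (Y i) f p.
Proof. by move=> df XE; rewrite /vf_act XE; exact: derive_lincomb. Qed.

End VectorFieldDerivations.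

(* Otherwise unification unfolds directional derivatives down to limits. *)
#[local] Opaque vf_act.

(** * Flatness of the connection of a parallel frame *)

Lemma sum_delta_mul (R : pzRingType) (n : nat) (F : 'I_n -> R) (j : 'I_n) :
  \sum_i (i == j)%:R * F i = F j.
Proof.
rewrite (bigD1 j) //= eqxx mul1r big1 ?addr0// => i /negPf iN.
by rewrite iN mul0r.
Qed.

(* The coefficients omega^a_b(X) = A_i^a X(B_ib) of the connection that makes
   every frame field A_i parallel, B being the coframe of A. *)
Section ParallelFrame.
Context (R : realType) (n : nat).
Implicit Types (X Y : vfield R n) (p q : tcoord R n).
Context (A B : 'I_n -> 'I_n -> scal R n).

Definition omega X (a b : 'I_n) : scal R n :=
  fun q => \sum_i A i a q * vf_act X (B i b) q.

Definition dual_frames_at q : Prop :=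
  (forall i j, \sum_a A i a q * B j a q = (i == j)%:R) /\
  (forall a b, \sum_i A i a q * B i b q = (a == b)%:R).

(** Frees an index contracted with the coframe: identities are checked on every coframe element and
    then transported back. *)
Lemma coframe_cancel q (u : 'I_n -> R) a : dual_frames_at q ->
  \sum_i A i a q * (\sum_b B i b q * u b) = u a.
Proof.
move=> [_ AB2]; under eq_bigr do rewrite mulr_sumr; rewrite exchange_big /=.
under eq_bigr => b _.
  under eq_bigr => i _ do rewrite mulrA.
  rewrite -mulr_suml AB2 eq_sym; over.
exact: sum_delta_mul.
Qed.

Context (p : tcoord R n).
Hypothesis AB : \forall q \near p, dual_frames_at q.
Hypothesis dA : forall i a, differentiable (A i a) p.
Hypothesis dB : forall i a, twice_differentiable (B i a) p.

Lemma differentiable_omega X a b :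
  differentiable X p -> differentiable (omega X a b) p.
Proof.
move=> dX; apply: differentiable_fun_sum => i.
by apply: differentiable_fun_mul => //; exact: differentiable_vf_act.
Qed.

Lemma omega_lincomb (I : finType) X (c : I -> R) (Y : I -> vfield R n) a b :
  X p = \sum_i c i *: Y i p ->
  omega X a b p = \sum_i c i * omega (Y i) a b p.
Proof.
move=> XE; rewrite /omega.
transitivity (\sum_j \sum_i A j a p * (c i * vf_act (Y i) (B j b) p)).
  apply: eq_bigr => j _; rewrite -mulr_sumr; congr (_ * _).
  exact: vf_act_lincomb (twice_differentiable_diff (dB j b)) XE.
rewrite exchange_big; apply: eq_bigr => i _; rewrite mulr_sumr.
by apply: eq_bigr => j _; rewrite mulrCA.
Qed.

(** Parallelism of the coframe. It is stated at any point [q] of duality, so that it holds near [p]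
    and can be differentiated again. *)
Lemma vf_act_coframe X i b q : dual_frames_at q ->
  vf_act X (B i b) q = \sum_a B i a q * omega X a b q.
Proof.
move=> [AB1 _]; under eq_bigr do rewrite mulr_sumr.
rewrite exchange_big /=.
under eq_bigr => j _.
  under eq_bigr => a _ do rewrite mulrCA mulrA.
  rewrite -mulr_suml AB1; over.
by rewrite sum_delta_mul.
Qed.

(** The pairings of [A] with [B] are constant near [p]; differentiating them moves the derivative
    from the frame to the coframe with a sign. *)
Lemma vf_act_frame X i a :
  vf_act X (A i a) p = - \sum_b A i b p * omega X a b p.
Proof.
have dB1 j b := twice_differentiable_diff (dB j b).
have D j : \sum_b B j b p * vf_act X (A i b) p =
    - \sum_b A i b p * vf_act X (B j b) p.
  apply/eqP; rewrite -subr_eq0 opprK -big_split /=; apply/eqP.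
  transitivity (vf_act X (fun q => \sum_b A i b q * B j b q) p).
    rewrite vf_act_sum => [|b]; last exact: differentiable_fun_mul.
    by apply: eq_bigr => b _; rewrite vf_act_mul// addrC.
  rewrite (@near_eq_vf_act _ _ _ _ (fun=> (i == j)%:R)) ?vf_act_cst//.
  by apply: filterS AB => q [].
rewrite -[LHS](coframe_cancel (fun b => vf_act X (A i b) p) a
  (nbhs_singleton AB)).
under eq_bigr do rewrite D mulrN mulr_sumr.
rewrite sumrN exchange_big /=; congr (- _); apply: eq_bigr => b _.
by rewrite mulr_sumr; apply: eq_bigr => j _; rewrite mulrCA.
Qed.

Lemma vf_act_vf_act_coframe X Y i b : differentiable Y p ->
  vf_act X (vf_act Y (B i b)) p = \sum_a B i a p *
    (vf_act X (omega Y a b) p + \sum_e omega X a e p * omega Y e b p).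
Proof.
move=> dY; have dB1 j c := twice_differentiable_diff (dB j c).
have dO a : differentiable (omega Y a b) p by exact: differentiable_omega.
rewrite (@near_eq_vf_act _ _ _ _ (fun q => \sum_a B i a q * omega Y a b q)).
  rewrite vf_act_sum => [|a]; last exact: differentiable_fun_mul.
  under eq_bigr => a _.
    rewrite vf_act_mul// (vf_act_coframe _ _ _ (nbhs_singleton AB)).
    rewrite mulr_sumr; over.
  rewrite big_split /= exchange_big -big_split; apply: eq_bigr => a _ /=.
  rewrite mulrDr mulr_sumr; congr (_ + _); apply: eq_bigr => e _.
  by rewrite mulrC mulrA.
by apply: filterS AB => q; exact: vf_act_coframe.
Qed.

(** Antisymmetrising [vf_act_vf_act_coframe] in [X] and [Y] gives the left-hand side contracted with
    the coframe, while the commutator gives the derivative of the coframe along the bracket;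
    [coframe_cancel] removes the coframe. *)
Lemma omega_flat X Y a b : differentiable X p -> differentiable Y p ->
  vf_act X (omega Y a b) p - vf_act Y (omega X a b) p
  + \sum_e (omega X a e p * omega Y e b p - omega Y a e p * omega X e b p)
  = omega (lie_bracket X Y) a b p.
Proof.
move=> dX dY; have ABp := nbhs_singleton AB.
pose F c := vf_act X (omega Y c b) p - vf_act Y (omega X c b) p
  + \sum_e (omega X c e p * omega Y e b p - omega Y c e p * omega X e b p).
have FE i : \sum_c B i c p * F c = vf_act (lie_bracket X Y) (B i b) p.
  rewrite -vf_act_commutator// !vf_act_vf_act_coframe// -sumrB.
  apply: eq_bigr => c _; by rewrite -mulrBr /F sumrB opprD addrACA.
rewrite -[LHS]/(F a) -(coframe_cancel F a ABp).
by apply: eq_bigr => i _; rewrite FE.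
Qed.

End ParallelFrame.

(** * Curvature of a d-connection through its connection forms *)

Section CurvatureComponents.
Context (R : realType) (n : nat) (N : 'I_n -> 'I_n -> scal R n).
Implicit Types (X Y Z : vfield R n) (D : dconnection R n) (p q : tcoord R n).

Lemma hcomp_lincomb (w u : 'I_n -> R) mu p :
  (\sum_al w al *: delta N al p + \sum_a u a *: partial_y a p).1 0 mu = w mu.
Proof.
rewrite /= !(raddf_sum (@fst _ _)) mxE !summxE /= [X in _ + X]big1 ?addr0.
  under eq_bigr => al _.
    rewrite mxE -[(delta N al p).1 0 mu]/(hcomp (delta N al) mu p).
    rewrite hcomp_delta eq_sym; over.
  exact: sum_eq_mul.
by move=> a _; rewrite scaler0 mxE.
Qed.

(** The fields [delta] contribute nothing, since their [- N] entries cancel the [N] correction in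
    [vcomp]. *)
Lemma vcomp_lincomb (w u : 'I_n -> R) X a p :
  X p = \sum_al w al *: delta N al p + \sum_b u b *: partial_y b p ->
  vcomp N X a p = u a.
Proof.
move=> XE; rewrite /vcomp; under eq_bigr do rewrite XE hcomp_lincomb.
rewrite XE /= !(raddf_sum (@snd _ _)) mxE !summxE /=.
rewrite addrAC -[X in X + _]big_split /= [X in X + _]big1 ?add0r.
  under eq_bigr do rewrite !mxE eqxx /= eq_sym.
  exact: sum_eq_mul.
move=> al _.
have dE mu : (delta N al p).1 0 mu = (mu == al)%:R := hcomp_delta N al mu p.
have dN : (delta N al p).2 0 a + N a al p = 0.
  rewrite -[RHS](vcomp_delta N al a p) -(sum_eq_mul (fun mu => N a mu p) al).
  by congr (_ + _); apply: eq_bigr => mu _; rewrite dE.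
by rewrite [X in X + _]mxE [N a al p * _]mulrC -mulrDr dN mulr0.
Qed.

(** The horizontal block of the connection form of [D] evaluated on [X]; [vconn] is the vertical
    block. There is no mixed block because both distributions are preserved. *)
Definition hconn D X (al mu : 'I_n) : scal R n := fun p =>
  \sum_nu Gh D al mu nu p * hcomp X nu p
  + \sum_c Ch D al mu c p * vcomp N X c p.

Definition vconn D X (a b : 'I_n) : scal R n := fun p =>
  \sum_nu Gv D a b nu p * hcomp X nu p
  + \sum_c Cv D a b c p * vcomp N X c p.

Lemma hcomp_nabla D X Z al p : hcomp (nabla N D X Z) al p =
  vf_act X (hcomp Z al) p + \sum_mu hcomp Z mu p * hconn D X al mu p.
Proof.
rewrite [LHS]hcomp_lincomb -addrA -big_split /=; congr (_ + _).
apply: eq_bigr => mu _; rewrite mulrDr !mulr_sumr.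
by congr (_ + _); apply: eq_bigr => e _; rewrite mulrA [hcomp Z _ _ * _]mulrC.
Qed.

Lemma vcomp_nabla D X Z a p : vcomp N (nabla N D X Z) a p =
  vf_act X (vcomp N Z a) p + \sum_b vcomp N Z b p * vconn D X a b p.
Proof.
rewrite (vcomp_lincomb _ (erefl (nabla N D X Z p))) -addrA -big_split /=.
congr (_ + _); apply: eq_bigr => b _; rewrite mulrDr !mulr_sumr.
by congr (_ + _); apply: eq_bigr => e _; rewrite mulrA [vcomp _ Z _ _ * _]mulrC.
Qed.

Lemma hcomp_nabla_delta D X be al p :
  hcomp (nabla N D X (delta N be)) al p = hconn D X al be p.
Proof.
rewrite hcomp_nabla; under eq_bigr do rewrite hcomp_delta.
have -> : hcomp (delta N be) al = (fun=> (al == be)%:R).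
  by apply/funext => q; exact: hcomp_delta.
by rewrite vf_act_cst add0r sum_delta_mul.
Qed.

Lemma vcomp_nabla_partial_y D X b a p :
  vcomp N (nabla N D X (partial_y b)) a p = vconn D X a b p.
Proof.
rewrite vcomp_nabla; under eq_bigr do rewrite vcomp_partial_y.
have -> : vcomp N (partial_y b) a = (fun=> (a == b)%:R).
  by apply/funext => q; exact: vcomp_partial_y.
by rewrite vf_act_cst add0r sum_delta_mul.
Qed.

(** Cartan's structure expression without its bracket term, kept abstract in the two matrices so
    that it serves both [omega] and the connection forms of any [D]. *)
Definition curvature_form X Y (oX oY : 'I_n -> 'I_n -> scal R n)
    (a b : 'I_n) : scal R n := fun p =>
  vf_act X (oY a b) p - vf_act Y (oX a b) p
  + \sum_e (oX a e p * oY e b p - oY a e p * oX e b p).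

Lemma hcompB X Y Z al p : X p = Y p - Z p ->
  hcomp X al p = hcomp Y al p - hcomp Z al p.
Proof. by move=> XE; rewrite /hcomp XE /= !mxE. Qed.

Lemma vcompB X Y Z a p : X p = Y p - Z p ->
  vcomp N X a p = vcomp N Y a p - vcomp N Z a p.
Proof.
move=> XE; rewrite /vcomp XE /= !mxE opprD addrACA -sumrB.
by congr (_ + _); apply: eq_bigr => mu _; rewrite !mxE mulrBr.
Qed.

(** Cartan's second structure equation for the horizontal block. The components of the inner
    derivative are the functions [hconn], so applying [hcomp_nabla] once more yields their
    derivatives and the products of forms. *)
Lemma hcomp_curvature D X Y be al p :
  hcomp (curvature N D X Y (delta N be)) al p =
  curvature_form X Y (hconn D X) (hconn D Y) al be p
  - hconn D (lie_bracket X Y) al be p.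
Proof.
rewrite (@hcompB _ (fun q => nabla N D X (nabla N D Y (delta N be)) q
    - nabla N D Y (nabla N D X (delta N be)) q)
    (nabla N D (lie_bracket X Y) (delta N be)))//.
rewrite (@hcompB _ (nabla N D X (nabla N D Y (delta N be)))
    (nabla N D Y (nabla N D X (delta N be))))//.
have E U e : hcomp (nabla N D U (delta N be)) e = hconn D U e be.
  by apply/funext => q; exact: hcomp_nabla_delta.
rewrite (hcomp_nabla D X (nabla N D Y (delta N be))).
rewrite (hcomp_nabla D Y (nabla N D X (delta N be))).
rewrite (E X al) (E Y al) (hcomp_nabla_delta D (lie_bracket X Y)).
congr (_ - _); rewrite opprD addrACA -sumrB; congr (_ + _).
by apply: eq_bigr => e _; rewrite (E X e) (E Y e) !(mulrC (hconn _ _ e be p)).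
Qed.

Lemma vcomp_curvature D X Y b a p :
  vcomp N (curvature N D X Y (partial_y b)) a p =
  curvature_form X Y (vconn D X) (vconn D Y) a b p
  - vconn D (lie_bracket X Y) a b p.
Proof.
rewrite (@vcompB _ (fun q => nabla N D X (nabla N D Y (partial_y b)) q
    - nabla N D Y (nabla N D X (partial_y b)) q)
    (nabla N D (lie_bracket X Y) (partial_y b)))//.
rewrite (@vcompB _ (nabla N D X (nabla N D Y (partial_y b)))
    (nabla N D Y (nabla N D X (partial_y b))))//.
have E U e : vcomp N (nabla N D U (partial_y b)) e = vconn D U e b.
  by apply/funext => q; exact: vcomp_nabla_partial_y.
rewrite (vcomp_nabla D X (nabla N D Y (partial_y b))).
rewrite (vcomp_nabla D Y (nabla N D X (partial_y b))).
rewrite (E X a) (E Y a) (vcomp_nabla_partial_y D (lie_bracket X Y)).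
congr (_ - _); rewrite opprD addrACA -sumrB; congr (_ + _).
by apply: eq_bigr => e _; rewrite (E X e) (E Y e) !(mulrC (vconn _ _ e b p)).
Qed.

Lemma hconn_delta D nu : hconn D (delta N nu) = fun al mu => Gh D al mu nu.
Proof.
apply/funext => al; apply/funext => mu; apply/funext => p; rewrite /hconn.
under eq_bigr do rewrite hcomp_delta.
by rewrite sum_eq_mul big1 ?addr0// => c _; rewrite vcomp_delta mulr0.
Qed.

Lemma vconn_delta D nu : vconn D (delta N nu) = fun a b => Gv D a b nu.
Proof.
apply/funext => a; apply/funext => b; apply/funext => p; rewrite /vconn.
under eq_bigr do rewrite hcomp_delta.
by rewrite sum_eq_mul big1 ?addr0// => c _; rewrite vcomp_delta mulr0.
Qed.

(** Only the value of [X] at [p] enters, so the lemma applies to brackets, which are decomposed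
    below at that point alone. *)
Lemma hconn_vertical D X (k : 'I_n -> R) al mu p :
  X p = \sum_c k c *: partial_y c p ->
  hconn D X al mu p = \sum_c k c * Ch D al mu c p.
Proof.
move=> XE.
have {}XE : X p =
    \sum_al cst 0 al *: delta N al p + \sum_c k c *: partial_y c p.
  by rewrite XE [X in _ = X + _]big1 ?add0r// => e _; rewrite scale0r.
rewrite /hconn [X in X + _]big1 ?add0r => [|nu _]; last first.
  by rewrite /hcomp XE hcomp_lincomb mulr0.
by apply: eq_bigr => c _; rewrite (vcomp_lincomb c XE) mulrC.
Qed.

Lemma vconn_vertical D X (k : 'I_n -> R) a b p :
  X p = \sum_c k c *: partial_y c p ->
  vconn D X a b p = \sum_c k c * Cv D a b c p.
Proof.
move=> XE.
have {}XE : X p =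
    \sum_al cst 0 al *: delta N al p + \sum_c k c *: partial_y c p.
  by rewrite XE [X in _ = X + _]big1 ?add0r// => e _; rewrite scale0r.
rewrite /vconn [X in X + _]big1 ?add0r => [|nu _]; last first.
  by rewrite /hcomp XE hcomp_lincomb mulr0.
by apply: eq_bigr => c _; rewrite (vcomp_lincomb c XE) mulrC.
Qed.

Lemma partial_y_delta_sum c p :
  partial_y c p = \sum_a (a == c)%:R *: partial_y a p :> tcoord R n.
Proof.
rewrite (bigD1 c)//= eqxx scale1r big1 ?addr0// => a /negPf ->.
by rewrite scale0r.
Qed.

Lemma hconn_partial_y D c : hconn D (partial_y c) = fun al mu => Ch D al mu c.
Proof.
apply/funext => al; apply/funext => mu; apply/funext => p.
by rewrite (hconn_vertical _ _ _ (partial_y_delta_sum c p)) sum_delta_mul.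
Qed.

Lemma vconn_partial_y D c : vconn D (partial_y c) = fun a b => Cv D a b c.
Proof.
apply/funext => a; apply/funext => b; apply/funext => p.
by rewrite (vconn_vertical _ _ _ (partial_y_delta_sum c p)) sum_delta_mul.
Qed.

End CurvatureComponents.

(** * Lie brackets of the adapted frame *)

Section AdaptedBrackets.
Context (R : realType) (n : nat) (N : 'I_n -> 'I_n -> scal R n).
Context (p : tcoord R n).
Implicit Types (X Y : vfield R n).

Lemma differentiable_tcoef X :
  (forall j, differentiable (fun q => tcoef j (X q)) p) -> differentiable X p.
Proof.
move=> dX.
have -> : X = (fun q => \sum_j tcoef j (X q) *: tbasis R j).
  by apply/funext => q; exact: tbasis_decomp.
elim: (index_enum _) => [|j s IHs].
  have -> : (fun q => \sum_(j <- [::]) tcoef j (X q) *: tbasis R j) = cst 0.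
    by apply/funext => q; rewrite big_nil.
  exact: differentiable_cst.
have -> : (fun q => \sum_(i <- j :: s) tcoef i (X q) *: tbasis R i) =
    (fun q => tcoef j (X q) *: tbasis R j)
    + (fun q => \sum_(i <- s) tcoef i (X q) *: tbasis R i).
  by apply/funext => q; rewrite big_cons.
by apply: differentiableD => //; exact: differentiableZl.
Qed.

(** An equality of functions rather than of values, so that it can be substituted under a
    directional derivative. *)
Lemma tcoef_delta mu : (fun j q => tcoef j (delta N mu q)) =
  (fun j => match j with inl m => fun=> (m == mu)%:R
                       | inr a => fun q => - N a mu q end).
Proof.
apply/funext => -[m|a]; apply/funext => q; first exact: hcomp_delta.
apply/eqP; rewrite -subr_eq0 opprK /=; apply/eqP.
rewrite -[RHS](vcomp_delta N mu a q).
congr (_ + _); rewrite -(sum_eq_mul (fun al => N a al q) mu).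
by apply: eq_bigr => al _; rewrite -(hcomp_delta N mu al q).
Qed.

Lemma tcoef_partial_y c : (fun j q => tcoef j (partial_y c q)) =
  (fun j => fun=> match j with inl m => 0 | inr a => (a == c)%:R end) :>
  ('I_n + 'I_n -> scal R n).
Proof.
apply/funext => -[m|a]; apply/funext => q /=; first by rewrite mxE.
by rewrite mxE eqxx.
Qed.

Lemma differentiable_partial_y c :
  differentiable (@partial_y R n c) p.
Proof. exact: differentiable_cst. Qed.

Lemma tcoef_lie_bracket X Y j : differentiable X p -> differentiable Y p ->
  tcoef j (lie_bracket X Y p) = vf_act X (fun q => tcoef j (Y q)) p
                              - vf_act Y (fun q => tcoef j (X q)) p.
Proof.
move=> dX dY; rewrite /lie_bracket linearB.
by congr (_ - _); apply: esym; apply: derive_lin => //; exact: tcoef_continuous.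
Qed.

Lemma vertical_decomp (w : tcoord R n) : (forall m, tcoef (inl m) w = 0) ->
  w = \sum_a tcoef (inr a) w *: partial_y a p.
Proof.
move=> w0; rewrite {1}[w]tbasis_decomp big_sumType /= big1 ?add0r// => m _.
by rewrite -[w.1 0 m]/(tcoef (inl m) w) w0 scale0r.
Qed.

Lemma vf_act_opp X (f : scal R n) : differentiable f p ->
  vf_act X (fun q => - f q) p = - vf_act X f p.
Proof. by move=> df; apply: deriveN; exact: diff_derivable. Qed.

Hypothesis dN : forall a mu, differentiable (N a mu) p.

Lemma differentiable_delta mu : differentiable (delta N mu) p.
Proof.
apply: differentiable_tcoef => j.
rewrite (congr1 (fun F => F j) (tcoef_delta mu)); case: j => [m|a].
  exact: differentiable_cst.
exact: differentiableN.
Qed.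

(** The [x]-components of the frame fields are constant, so the bracket is vertical; its
    [y]-components come from differentiating [- N]. *)
Lemma lie_bracket_delta_delta mu nu : lie_bracket (delta N mu) (delta N nu) p =
  \sum_a nlcurv N a mu nu p *: partial_y a p.
Proof.
have dd := differentiable_delta.
have tE j mu' := congr1 (fun F => F j) (tcoef_delta mu').
rewrite [LHS]vertical_decomp => [|m]; last first.
  by rewrite tcoef_lie_bracket// !tE !vf_act_cst subrr.
apply: eq_bigr => a _; rewrite tcoef_lie_bracket// !tE !vf_act_opp// opprK.
by rewrite addrC.
Qed.

Lemma lie_bracket_partial_y_delta c nu :
  lie_bracket (partial_y c) (delta N nu) p =
  \sum_a - dv c (N a nu) p *: partial_y a p.
Proof.
have dd := differentiable_delta; have dy := differentiable_partial_y.
have tE j mu' := congr1 (fun F => F j) (tcoef_delta mu').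
have yE j c' := congr1 (fun F => F j) (tcoef_partial_y c').
rewrite [LHS]vertical_decomp => [|m]; last first.
  by rewrite tcoef_lie_bracket// tE yE !vf_act_cst subrr.
apply: eq_bigr => a _; rewrite tcoef_lie_bracket// tE yE vf_act_cst subr0.
by rewrite vf_act_opp.
Qed.

Lemma lie_bracket_partial_y_partial_y b c :
  lie_bracket (partial_y b) (partial_y c) p =
  \sum_a 0 *: partial_y a p :> tcoord R n.
Proof.
have dy := differentiable_partial_y.
have yE j c' := congr1 (fun F => F j) (tcoef_partial_y c').
have t0 j : tcoef j (lie_bracket (partial_y b) (partial_y c) p) = 0.
  by rewrite tcoef_lie_bracket// !yE !vf_act_cst subrr.
rewrite [LHS]vertical_decomp => [|m //].
by apply: eq_bigr => a _; rewrite t0.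
Qed.

End AdaptedBrackets.

(** * Index algebra for transposed connection coefficients *)

Section DualAlgebra.
Context (R : realFieldType) (n : nat).
Implicit Types (G C : 'I_n -> 'I_n -> 'I_n -> R).

Lemma sum_mulBl (F G H : 'I_n -> R) :
  \sum_e (F e - G e) * H e = \sum_e F e * H e - \sum_e G e * H e.
Proof. by rewrite -sumrB; apply: eq_bigr => e _; rewrite mulrBl. Qed.

Lemma sum_mulC (F G : 'I_n -> R) : \sum_e F e * G e = \sum_e G e * F e.
Proof. by apply: eq_bigr => e _; rewrite mulrC. Qed.

(* Two instances of the flatness hypothesis, a cyclic shift of the indices
   apart, turn the curvature of the transposed coefficients into a covariant
   derivative of the torsion [G - G^T]. *)
Lemma flat_transpose_curvature G (dG : 'I_n -> 'I_n -> 'I_n -> 'I_n -> R)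
    (K : 'I_n -> 'I_n -> 'I_n -> 'I_n -> R) :
  (forall al be mu nu, dG mu al be nu - dG nu al be mu
     + \sum_e (G al e mu * G e be nu - G al e nu * G e be mu)
     = K al be mu nu) ->
  forall al be nu mu,
    dG nu al mu be - dG mu al nu be
    + \sum_e (G al nu e * G e mu be - G al mu e * G e nu be)
    = dG be al mu nu - dG be al nu mu
      + \sum_e (G e mu nu - G e nu mu) * G al e be
      - \sum_e (G al e nu - G al nu e) * G e mu be
      - \sum_e (G al mu e - G al e mu) * G e nu be
      - K al mu be nu + K al nu be mu.
Proof.
move=> flat al be nu mu; have := flat al mu be nu; have := flat al nu be mu.
rewrite !sumrB !sum_mulBl.
rewrite (sum_mulC (fun e => G e mu nu)) (sum_mulC (fun e => G e nu mu)).
lra.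
Qed.

(** Only [G] is transposed, so a single flatness identity suffices. The two sums against [C e mu c]
    cancel; one belongs to the covariant derivative of the torsion, the other is the extra quadratic
    term of the mixed curvature. *)
Lemma flat_mixed_curvature_h G C (dG dC : 'I_n -> 'I_n -> 'I_n -> 'I_n -> R)
    (K : 'I_n -> 'I_n -> 'I_n -> 'I_n -> R) :
  (forall al be nu c, dG c al be nu - dC nu al be c
     + \sum_e (C al e c * G e be nu - G al e nu * C e be c)
     = K al be nu c) ->
  forall al be mu c,
    dG c al mu be - dC mu al be c
    + \sum_e (C al e c * G e mu be - G al mu e * C e be c)
    - K al be mu c
    = dG c al mu be - dG c al be mu
      + \sum_e (G e mu be - G e be mu) * C al e c
      - \sum_e (G al e be - G al be e) * C e mu c
      - \sum_e (G al mu e - G al e mu) * C e be c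
      + \sum_e (G al e be - G al be e) * C e mu c.
Proof.
move=> flat al be mu c; have := flat al be mu c; rewrite !sumrB !sum_mulBl.
rewrite (sum_mulC (fun e => G e mu be)) (sum_mulC (fun e => G e be mu)).
lra.
Qed.

(** Only [C] is transposed, and the bracket terms of the two connections differ by [k] times the
    torsion. The [G d c mu] part of the last sum cancels the correction for the index [c], which
    completes both the covariant derivative and the torsion [k - G]. *)
Lemma flat_mixed_curvature_v G C (dG dC : 'I_n -> 'I_n -> 'I_n -> 'I_n -> R)
    (k : 'I_n -> 'I_n -> 'I_n -> R) :
  (forall a b nu c, dG c a b nu - dC nu a b c
     + \sum_e (C a e c * G e b nu - G a e nu * C e b c)
     = \sum_d - k d nu c * C a b d) ->
  forall a b mu c,
    dG c a b mu - dC mu a c b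
    + \sum_e (C a c e * G e b mu - G a e mu * C e c b)
    - \sum_d - k d mu c * C a d b
    = dC mu a b c - dC mu a c b
      + \sum_e (C e b c - C e c b) * G a e mu
      - \sum_e (C a e c - C a c e) * G e b mu
      - \sum_e (C a b e - C a e b) * G e c mu
      + \sum_d (C a d b - C a b d) * (k d mu c - G d c mu).
Proof.
move=> flat a b mu c; have := flat a b mu c; rewrite !sumrB !sum_mulBl.
have E (F : 'I_n -> R) : \sum_d F d * (k d mu c - G d c mu) =
    \sum_d k d mu c * F d - \sum_d F d * G d c mu.
  by rewrite -sumrB; apply: eq_bigr => d _; rewrite mulrBr [k _ _ _ * _]mulrC.
have EN (F : 'I_n -> R) :
    \sum_d - k d mu c * F d = - \sum_d k d mu c * F d.
  by rewrite -sumrN; apply: eq_bigr => d _; rewrite mulNr.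
rewrite !E !EN (sum_mulC (fun e => C e b c)) (sum_mulC (fun e => C e c b)).
lra.
Qed.

End DualAlgebra.

(** * Covariant derivatives of skew tensors, traces and raised indices *)

Section Contractions.
Context (R : realType) (n : nat) (p : tcoord R n).
Context (X : 'I_n -> vfield R n) (G : 'I_n -> 'I_n -> 'I_n -> scal R n).
Local Notation d := (fun m => vf_act (X m)).

Lemma cov12_skew (T : 'I_n -> 'I_n -> 'I_n -> scal R n) i j k m :
  (forall i j k, differentiable (T i j k) p) ->
  (forall i j k q, T i j k q = - T i k j q) ->
  cov12 d G T i j k m p = - cov12 d G T i k j m p.
Proof.
move=> dT skT; rewrite /cov12.
have -> : T i j k = fun q => - T i k j q by apply/funext => q; exact: skT.
rewrite vf_act_opp//.
have skS (F H : 'I_n -> R) (K : 'I_n -> R) : (forall e, F e = - H e) ->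
    \sum_e F e * K e = - \sum_e H e * K e.
  by move=> FH; rewrite -sumrN; apply: eq_bigr => e _; rewrite FH mulNr.
rewrite (skS (fun e => T e j k p) (fun e => T e k j p));
  last by move=> e; exact: skT.
rewrite (skS (fun e => T i e k p) (fun e => T i k e p));
  last by move=> e; exact: skT.
rewrite (skS (fun e => T i j e p) (fun e => T i e j p));
  last by move=> e; exact: skT.
by rewrite !opprD !opprK addrAC.
Qed.

(** The connection terms of the two contracted indices cancel after exchanging the summations. *)
Lemma cov12_trace (T : 'I_n -> 'I_n -> 'I_n -> scal R n) j m :
  (forall i j k, differentiable (T i j k) p) ->
  \sum_i cov12 d G T i j i m p =
  cov01 d G (fun j q => \sum_i T i j i q) j m p.
Proof.
move=> dT; rewrite /cov12 /cov01 !sumrB big_split /= vf_act_sum//.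
have -> : \sum_i \sum_e T i j e p * G e i m p =
    \sum_i \sum_e T e j i p * G i e m p by exact: exchange_big.
rewrite addrAC addrK; congr (_ - _); rewrite exchange_big /=.
by apply: eq_bigr => e _; rewrite mulr_suml.
Qed.

(* The last hypothesis says that g is parallel: raising an index then commutes
   with covariant derivation. *)
Lemma divergence_raise (g : 'I_n -> 'I_n -> scal R n) (C : 'I_n -> scal R n) :
  (forall a b, differentiable (g a b) p) ->
  (forall a, differentiable (C a) p) ->
  (forall a b, g a b p = g b a p) ->
  (forall m a b, vf_act (X m) (g a b) p =
     - \sum_e (g a e p * G b e m p + g b e p * G a e m p)) ->
  \sum_m cov10 d G (fun a q => \sum_b g a b q * C b q) m m p =
  \sum_b \sum_a g b a p * cov01 d G C a b p.
Proof.
move=> dg dC sg Dg; apply: eq_bigr => m _; rewrite /cov10 /cov01.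
rewrite vf_act_sum => [|b]; last exact: differentiable_fun_mul.
under eq_bigr do rewrite vf_act_mul//.
under [RHS]eq_bigr do rewrite mulrBr.
rewrite big_split sumrB /= -addrA; congr (_ + _).
under eq_bigr do rewrite Dg big_split /= opprD mulrDr !mulrN.
rewrite big_split /= !sumrN -addrA -[RHS]addr0; congr (_ + _).
  congr (- _); under eq_bigr do rewrite mulr_sumr.
  rewrite exchange_big /=; apply: eq_bigr => e _; rewrite mulr_sumr.
  by apply: eq_bigr => b _; rewrite mulrCA.
(* The connection term of the raised index cancels the other half of the derivative of [g]. *)
apply/eqP; rewrite addrC subr_eq0; apply/eqP.
under eq_bigr do rewrite mulr_suml.
under [RHS]eq_bigr do rewrite mulr_sumr.
rewrite exchange_big /=; apply: eq_bigr => b _; apply: eq_bigr => e _.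
by rewrite sg -mulrA mulrCA.
Qed.

End Contractions.

(** * The metric of a frame and its inverse *)

Section FrameMetric.
Context (R : realType) (n : nat) (A B : 'I_n -> 'I_n -> scal R n).
Implicit Types (p q : tcoord R n).

(** The contravariant metric, by [invmx_coframe_metric]; written with the frame instead of a matrix
    inverse, it is differentiated directly by [vf_act_frame]. *)
Definition frame_metric (a b : 'I_n) : scal R n :=
  fun q => \sum_i A i a q * A i b q.

Lemma vf_act_frame_metric p (X : vfield R n) a b :
  (\forall q \near p, dual_frames_at A B q) ->
  (forall i a, differentiable (A i a) p) ->
  (forall i a, twice_differentiable (B i a) p) ->
  vf_act X (frame_metric a b) p =
  - \sum_e (frame_metric a e p * omega A B X b e p
            + frame_metric b e p * omega A B X a e p).
Proof.
move=> AB dA dB; rewrite vf_act_sum => [|i]; last exact: differentiable_fun_mul.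
under eq_bigr => i _.
  rewrite vf_act_mul// !(vf_act_frame AB dA dB) !mulrN -opprD !mulr_sumr.
  rewrite -big_split /=; over.
rewrite sumrN exchange_big /=; congr (- _); apply: eq_bigr => e _.
rewrite big_split /= !mulr_suml; congr (_ + _);
  by apply: eq_bigr => i _; rewrite mulrA.
Qed.

Lemma dual_frames_invmx q :
  (forall i a, B i a q = invmx (\matrix_(i, a) A i a q) a i) ->
  (\matrix_(i, a) A i a q) \in unitmx -> dual_frames_at A B q.
Proof.
set L := \matrix_(i, a) _ => BE uL; split => [i j|a b].
  have := congr1 (fun M : 'M[R]_n => M i j) (mulmxV uL); rewrite !mxE => <-.
  by apply: eq_bigr => a _; rewrite BE /L mxE.
have := congr1 (fun M : 'M[R]_n => M b a) (mulVmx uL); rewrite !mxE eq_sym => <-.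
by apply: eq_bigr => i _; rewrite BE /L mxE mulrC.
Qed.

(** With [L] the matrix of the frame, the covariant metric is [L^-1 L^-T], whose inverse is
    [L^T L]. *)
Lemma invmx_coframe_metric q a b :
  (forall i a, B i a q = invmx (\matrix_(i, a) A i a q) a i) ->
  (\matrix_(i, a) A i a q) \in unitmx ->
  invmx (\matrix_(a, b) \sum_i B i a q * B i b q) a b = frame_metric a b q.
Proof.
set L := \matrix_(i, a) _ => BE uL.
have -> : \matrix_(a, b) (\sum_i B i a q * B i b q) =
    invmx L *m (invmx L)^T.
  by apply/matrixP => c e; rewrite !mxE; apply: eq_bigr => i _; rewrite !BE !mxE.
have LK : (invmx L *m (invmx L)^T) *m (L^T *m L) = 1%:M.
  by rewrite mulmxA -[_ *m _ *m L^T]mulmxA -trmx_mul mulmxV// trmx1 mulmx1 mulVmx.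
have [uM _] := mulmx1_unit LK.
have -> : invmx (invmx L *m (invmx L)^T) = L^T *m L.
  by rewrite -[LHS]mulmx1 -LK mulmxA mulVmx// mul1mx.
by rewrite mxE; apply: eq_bigr => i _; rewrite !mxE.
Qed.

End FrameMetric.

Lemma sum_sym_skew (R : realFieldType) (n : nat) (g Q : 'I_n -> 'I_n -> R) :
  (forall a b, g a b = g b a) -> (forall a b, Q a b = - Q b a) ->
  \sum_a \sum_b g a b * Q a b = 0.
Proof.
move=> gs Qs; set S := \sum_a _.
have : S = - S.
  rewrite {1}/S exchange_big /S -sumrN; apply: eq_bigr => b _.
  by rewrite -sumrN; apply: eq_bigr => a _; rewrite gs Qs mulrN.
lra.
Qed.

(** * Flatness identities on the adapted frame *)

Section FlatComponents.
Context (R : realType) (n : nat) (N A B : 'I_n -> 'I_n -> scal R n).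
Context (p : tcoord R n).
Hypothesis dN : forall a mu, differentiable (N a mu) p.
Hypothesis AB : \forall q \near p, dual_frames_at A B q.
Hypothesis dA : forall i a, differentiable (A i a) p.
Hypothesis dB : forall i a, twice_differentiable (B i a) p.

Lemma flat_delta_delta mu nu a b :
  curvature_form (delta N mu) (delta N nu)
    (omega A B (delta N mu)) (omega A B (delta N nu)) a b p =
  \sum_c nlcurv N c mu nu p * omega A B (partial_y c) a b p.
Proof.
have flat := omega_flat AB dA dB a b (differentiable_delta dN mu)
  (differentiable_delta dN nu).
exact: etrans flat
  (omega_lincomb A dB a b (lie_bracket_delta_delta dN mu nu)).
Qed.

Lemma flat_partial_y_delta c nu a b :
  curvature_form (partial_y c) (delta N nu)
    (omega A B (partial_y c)) (omega A B (delta N nu)) a b p =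
  \sum_d - dv c (N d nu) p * omega A B (partial_y d) a b p.
Proof.
have flat := omega_flat AB dA dB a b (differentiable_partial_y p c)
  (differentiable_delta dN nu).
exact: etrans flat
  (omega_lincomb A dB a b (lie_bracket_partial_y_delta dN c nu)).
Qed.

Lemma flat_partial_y_partial_y c d a b :
  curvature_form (partial_y c) (partial_y d)
    (omega A B (partial_y c)) (omega A B (partial_y d)) a b p = 0.
Proof.
have flat := omega_flat AB dA dB a b (differentiable_partial_y p c)
  (differentiable_partial_y p d).
apply: etrans flat _.
rewrite (omega_lincomb A dB a b (lie_bracket_partial_y_partial_y p c d)).
by rewrite big1// => e _; rewrite mul0r.
Qed.

End FlatComponents.

(** * Curvature of the dual connection at a point of a chart *)

Section DualCurvature.
Context (R : realType) (n : nat) (N : 'I_n -> 'I_n -> scal R n).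
Context (lam : 'I_n -> vfield R n) (p : tcoord R n).
Hypothesis cN : forall a mu, twice_differentiable (N a mu) p.
Hypothesis clam :
  forall i j, twice_differentiable (fun q => tcoef j (lam i q)) p.
Hypothesis uh : \forall q \near p, lamh_mx lam q \in unitmx.
Hypothesis uv : \forall q \near p, lamv_mx N lam q \in unitmx.

Local Notation D := (canonical_dconn N lam).
Local Notation Dt := (dual_dconn D).
Local Notation L := (torsh N lam).
Local Notation P := (torsP N lam).
Local Notation T := (torsv N lam).
Local Notation Ah := (fun i => hcomp (lam i)).
Local Notation Av := (fun i => vcomp N (lam i)).

Let dN a mu : differentiable (N a mu) p := twice_differentiable_diff (cN a mu).

Let cAh i al : twice_differentiable (Ah i al) p.
Proof. exact: (clam i (inl al)). Qed.

Let cAv i a : twice_differentiable (Av i a) p.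
Proof.
apply: twice_differentiable_add; first exact: (clam i (inr a)).
apply: twice_differentiable_sum => mu.
exact: twice_differentiable_mul (cN a mu) (cAh i mu).
Qed.

Let dAh i al : differentiable (Ah i al) p :=
  twice_differentiable_diff (cAh i al).
Let dAv i a : differentiable (Av i a) p := twice_differentiable_diff (cAv i a).

Let cBh i al : twice_differentiable (colamh lam i al) p.
Proof.
apply: (@twice_differentiable_invmx _ _ _ (lamh_mx lam)) => // j b.
have -> : (fun q => lamh_mx lam q j b) = Ah j b; last exact: cAh.
by apply/funext => q; rewrite mxE.
Qed.

Let cBv i a : twice_differentiable (colamv N lam i a) p.
Proof.
apply: (@twice_differentiable_invmx _ _ _ (lamv_mx N lam)) => // j b.
have -> : (fun q => lamv_mx N lam q j b) = Av j b; last exact: cAv.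
by apply/funext => q; rewrite mxE.
Qed.

Let ABh : \forall q \near p, dual_frames_at Ah (colamh lam) q.
Proof. by apply: filterS uh => q; exact: dual_frames_invmx. Qed.

Let ABv : \forall q \near p, dual_frames_at Av (colamv N lam) q.
Proof. by apply: filterS uv => q; exact: dual_frames_invmx. Qed.

(** By conversion the canonical coefficients are [omega] along [delta] and [partial_y], so the
    results on parallel frames apply to them as they stand. *)
Let dGh al mu nu : differentiable (Gh D al mu nu) p.
Proof.
exact: (differentiable_omega dAh cBh _ _ (differentiable_delta dN nu)).
Qed.

Let dGv a b nu : differentiable (Gv D a b nu) p.
Proof.
exact: (differentiable_omega dAv cBv _ _ (differentiable_delta dN nu)).
Qed.

Let dCh al mu c : differentiable (Ch D al mu c) p.
Proof.
exact: (differentiable_omega dAh cBh _ _ (differentiable_partial_y p c)).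
Qed.

Let dCv a b c : differentiable (Cv D a b c) p.
Proof.
exact: (differentiable_omega dAv cBv _ _ (differentiable_partial_y p c)).
Qed.

Let dL al mu nu : differentiable (L al mu nu) p.
Proof. exact: differentiable_fun_sub. Qed.

Let dT a b c : differentiable (T a b c) p.
Proof. exact: differentiable_fun_sub. Qed.

Let vf_act_L X al mu nu : vf_act X (L al mu nu) p =
  vf_act X (Gh D al mu nu) p - vf_act X (Gh D al nu mu) p.
Proof. exact: vf_act_sub. Qed.

Let vf_act_T X a b c : vf_act X (T a b c) p =
  vf_act X (Cv D a b c) p - vf_act X (Cv D a c b) p.
Proof. exact: vf_act_sub. Qed.

Lemma nlcurv_skew a mu nu q : nlcurv N a mu nu q = - nlcurv N a nu mu q.
Proof. by rewrite /nlcurv opprB. Qed.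

(** Duality leaves [Ch] unchanged and the vertical coordinate fields commute, so this is a flatness
    identity of the canonical connection. *)
Lemma dual_curvSh al be b c : curvSh N Dt al be b c p = 0.
Proof.
rewrite /curvSh hcomp_curvature !hconn_partial_y.
rewrite (hconn_vertical _ _ _ _ (lie_bracket_partial_y_partial_y p b c)).
rewrite [X in _ - X]big1 ?subr0 => [|d _]; last by rewrite mul0r.
exact: (flat_partial_y_partial_y ABh dAh cBh).
Qed.

(** The first term of the cyclic sum comes from the bracket in the curvature of the dual connection,
    the other two from the right-hand sides of the two flatness identities. *)
Lemma dual_curvRh al be nu mu :
  curvRh N Dt al be nu mu p =
  cov12 (dh N) (Gh D) L al mu nu be p
  + (\sum_a Ch D al be a p * nlcurv N a mu nu p
     + \sum_a Ch D al mu a p * nlcurv N a nu be p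
     + \sum_a Ch D al nu a p * nlcurv N a be mu p).
Proof.
rewrite /curvRh hcomp_curvature !hconn_delta.
rewrite (hconn_vertical _ _ _ _ (lie_bracket_delta_delta dN nu mu)).
have flat al' be' mu' nu' :=
  flat_delta_delta dN ABh dAh cBh mu' nu' al' be'.
have E := @flat_transpose_curvature R n (fun a b c => Gh D a b c p)
  (fun m a b c => vf_act (delta N m) (Gh D a b c) p)
  (fun a b m m' => \sum_c nlcurv N c m m' p * Ch D a b c p) flat al be nu mu.
have K a b m m' : \sum_c Ch D a b c p * nlcurv N c m m' p =
    - \sum_c nlcurv N c m' m p * Ch D a b c p.
  by rewrite -sumrN; apply: eq_bigr => c _; rewrite nlcurv_skew mulrN mulrC.
have regroup (x y z t : R) : x - z + t - y = x + (- y - z + t) by ring.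
rewrite [X in X - _]E /cov12 [X in _ = X + _ - _ - _ + _]vf_act_L.
rewrite (K al be mu nu) (K al mu nu be) [X in _ = _ + (_ + X)]sum_mulC.
exact: regroup.
Qed.

(** [Gv] is unchanged by duality, so flatness evaluates the structure expression with [Cv], whereas
    the bracket term carries the transposed [Cv]; the difference is the torsion. *)
Lemma dual_curvRv a b nu mu :
  curvRv N Dt a b nu mu p = \sum_d nlcurv N d mu nu p * T a d b p.
Proof.
rewrite /curvRv vcomp_curvature !vconn_delta.
rewrite (vconn_vertical _ _ _ _ (lie_bracket_delta_delta dN nu mu)).
have flat := flat_delta_delta dN ABv dAv cBv nu mu a b.
apply: (etrans (congr1 (fun x => x - _) flat)); rewrite -sumrB.
by apply: eq_bigr => d _; rewrite -mulrBr nlcurv_skew mulNr -mulrN opprB.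
Qed.

Lemma dual_curvPh al be mu c :
  curvPh N Dt al be mu c p =
  cov12 dv (Ch D) L al mu be c p + \sum_ep L al ep be p * Ch D ep mu c p.
Proof.
rewrite /curvPh hcomp_curvature hconn_delta hconn_partial_y.
rewrite (hconn_vertical _ _ _ _ (lie_bracket_partial_y_delta dN c mu)).
have flat al' be' nu' c' :=
  flat_partial_y_delta dN ABh dAh cBh c' nu' al' be'.
have E := @flat_mixed_curvature_h R n (fun a b c => Gh D a b c p)
  (fun a b c => Ch D a b c p)
  (fun m a b c => vf_act (partial_y m) (Gh D a b c) p)
  (fun m a b c => vf_act (delta N m) (Ch D a b c) p)
  (fun a b m c => \sum_d - dv c (N d m) p * Ch D a b d p) flat al be mu c.
rewrite [LHS]E /cov12 [X in _ = X + _ - _ - _ + _]vf_act_L.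
by [].
Qed.

Lemma dual_curvPv a b mu c :
  curvPv N Dt a b mu c p =
  cov12 (dh N) (Gv D) T a b c mu p + \sum_d T a d b p * P d mu c p.
Proof.
rewrite /curvPv vcomp_curvature vconn_delta vconn_partial_y.
rewrite (vconn_vertical _ _ _ _ (lie_bracket_partial_y_delta dN c mu)).
have flat a' b' nu' c' :=
  flat_partial_y_delta dN ABv dAv cBv c' nu' a' b'.
have E := @flat_mixed_curvature_v R n (fun a b c => Gv D a b c p)
  (fun a b c => Cv D a b c p)
  (fun m a b c => vf_act (partial_y m) (Gv D a b c) p)
  (fun m a b c => vf_act (delta N m) (Cv D a b c) p)
  (fun d m c => dv c (N d m) p) flat a b mu c.
rewrite [LHS]E /cov12 [X in _ = X + _ - _ - _ + _]vf_act_T.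
by [].
Qed.

(** Vertical coordinate fields commute, so [flat_transpose_curvature] applies with zero right-hand
    side and only the covariant derivative survives. *)
Lemma dual_curvSv a b c d :
  curvSv N Dt a b c d p = cov12 dv (Cv D) T a d c b p.
Proof.
rewrite /curvSv vcomp_curvature !vconn_partial_y.
rewrite (vconn_vertical _ _ _ _ (lie_bracket_partial_y_partial_y p c d)).
rewrite [X in _ - X]big1 ?subr0 => [|e _]; last by rewrite mul0r.
have flat a' b' c' d' :=
  flat_partial_y_partial_y ABv dAv cBv c' d' a' b'.
have E := @flat_transpose_curvature R n (fun a b c => Cv D a b c p)
  (fun m a b c => vf_act (partial_y m) (Cv D a b c) p)
  (fun _ _ _ _ => 0) flat a b c d.
rewrite [LHS]E /cov12 [X in _ = X + _ - _ - _]vf_act_T.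
by rewrite subr0 addr0.
Qed.

Let torsh_skew al mu nu q : L al mu nu q = - L al nu mu q.
Proof. by rewrite /torsh opprB. Qed.

Let torsv_skew a b c q : T a b c q = - T a c b q.
Proof. by rewrite /torsv opprB. Qed.

Let nlcurv_trace be nu : scal R n := fun q =>
  \sum_al (\sum_a Ch D al be a q * nlcurv N a al nu q
           + \sum_a Ch D al nu a q * nlcurv N a be al q
           + \sum_a Ch D al al a q * nlcurv N a nu be q).

(** Skewness moves the contracted index of the torsion to the last place, where [contrh] contracts;
    this is the origin of the minus sign. *)
Lemma dual_Ricci_h be nu :
  \sum_al curvRh N Dt al be nu al p =
  - cov01 (dh N) (Gh D) (contrh N lam) nu be p + nlcurv_trace be nu p.
Proof.
under eq_bigr => al _.
  rewrite dual_curvRh (cov12_skew (delta N) (Gh D) _ _ _ _ dL torsh_skew).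
  rewrite [X in _ + X]addrAC; over.
rewrite big_split /= sumrN; congr (- _ + _).
exact: (cov12_trace (delta N) (Gh D) _ _ dL).
Qed.

Lemma dual_Ricci_hv be c :
  - \sum_al curvPh N Dt al be al c p =
  cov01 dv (Ch D) (contrh N lam) be c p
  + \sum_al \sum_ep L al be ep p * Ch D ep al c p.
Proof.
under eq_bigr => al _.
  rewrite dual_curvPh (cov12_skew (@partial_y R n) (Ch D) _ _ _ _ dL torsh_skew).
  over.
rewrite big_split /= sumrN opprD opprK; congr (_ + _).
  exact: (cov12_trace (@partial_y R n) (Ch D) _ _ dL).
rewrite -sumrN; apply: eq_bigr => al _; rewrite -sumrN.
by apply: eq_bigr => ep _; rewrite torsh_skew mulNr opprK.
Qed.

(** Here the contracted index of the torsion is already last, so no sign appears. *)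
Lemma dual_Ricci_vh b mu :
  \sum_a curvPv N Dt a b mu a p =
  cov01 (dh N) (Gv D) (contrv N lam) b mu p
  + \sum_a \sum_d T a d b p * P d mu a p.
Proof.
under eq_bigr do rewrite dual_curvPv.
rewrite big_split; congr (_ + _).
exact: (cov12_trace (delta N) (Gv D) _ _ dT).
Qed.

Lemma dual_Ricci_v b d :
  \sum_a curvSv N Dt a b d a p = - cov01 dv (Cv D) (contrv N lam) d b p.
Proof.
under eq_bigr => a _.
  rewrite dual_curvSv (cov12_skew (@partial_y R n) (Cv D) _ _ _ _ dT torsv_skew).
  over.
rewrite sumrN; congr (- _).
exact: (cov12_trace (@partial_y R n) (Cv D) _ _ dT).
Qed.

(** Equality near [p], not only at [p], is required because the inverse metric gets
    differentiated. *)
Let ginvhE a b : \forall q \near p, frame_metric Ah a b q = ginvh lam a b q.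
Proof.
apply: filterS uh => q uq; apply: esym.
exact: (@invmx_coframe_metric R n Ah (colamh lam)).
Qed.

Let ginvvE a b : \forall q \near p, frame_metric Av a b q = ginvv N lam a b q.
Proof.
apply: filterS uv => q uq; apply: esym.
exact: (@invmx_coframe_metric R n Av (colamv N lam)).
Qed.

Let ginvh_sym a b : ginvh lam a b p = ginvh lam b a p.
Proof.
rewrite -!(nbhs_singleton (ginvhE _ _)).
by apply: eq_bigr => i _; rewrite mulrC.
Qed.

Let ginvv_sym a b : ginvv N lam a b p = ginvv N lam b a p.
Proof.
rewrite -!(nbhs_singleton (ginvvE _ _)).
by apply: eq_bigr => i _; rewrite mulrC.
Qed.

Let dginvh a b : differentiable (ginvh lam a b) p.
Proof.
apply: near_eq_differentiable (ginvhE a b) _.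
by apply: differentiable_fun_sum => i; exact: differentiable_fun_mul.
Qed.

Let dginvv a b : differentiable (ginvv N lam a b) p.
Proof.
apply: near_eq_differentiable (ginvvE a b) _.
by apply: differentiable_fun_sum => i; exact: differentiable_fun_mul.
Qed.

Let vf_act_ginvh m a b : vf_act (delta N m) (ginvh lam a b) p =
  - \sum_e (ginvh lam a e p * Gh D b e m p + ginvh lam b e p * Gh D a e m p).
Proof.
rewrite -(near_eq_vf_act _ (ginvhE a b)).
rewrite (vf_act_frame_metric (delta N m) a b ABh dAh cBh).
congr (- _); apply: eq_bigr => e _.
by rewrite !(nbhs_singleton (ginvhE _ _)).
Qed.

Let vf_act_ginvv m a b : vf_act (partial_y m) (ginvv N lam a b) p =
  - \sum_e (ginvv N lam a e p * Cv D b e m p + ginvv N lam b e p * Cv D a e m p).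
Proof.
rewrite -(near_eq_vf_act _ (ginvvE a b)).
rewrite (vf_act_frame_metric (partial_y m) a b ABv dAv cBv).
congr (- _); apply: eq_bigr => e _.
by rewrite !(nbhs_singleton (ginvvE _ _)).
Qed.

(** The [nlcurv] terms of [dual_Ricci_h] are skew in the two free indices and vanish against the
    symmetric inverse metric; what remains is a divergence because the metric is parallel. *)
Lemma dual_scalar_h :
  \sum_be \sum_mu ginvh lam be mu p * (\sum_al curvRh N Dt al be mu al p) =
  - \sum_mu cov10 (dh N) (Gh D) (contrh_up N lam) mu mu p.
Proof.
have dC mu : differentiable (contrh N lam mu) p.
  by apply: differentiable_fun_sum => al; exact: dL.
have -> : \sum_mu cov10 (dh N) (Gh D) (contrh_up N lam) mu mu p =
    \sum_b \sum_a ginvh lam b a p *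
      cov01 (dh N) (Gh D) (contrh N lam) a b p.
  exact: (divergence_raise dginvh dC ginvh_sym vf_act_ginvh).
(* Exchanging [be] and [mu] swaps the first two sums and reverses the sign of every [nlcurv]. *)
have skew be mu : nlcurv_trace be mu p = - nlcurv_trace mu be p.
  rewrite /nlcurv_trace -sumrN; apply: eq_bigr => al _.
  rewrite !opprD -!sumrN [X in _ = X + _]addrC.
  by congr (_ + _ + _); apply: eq_bigr => a _; rewrite nlcurv_skew mulrN.
under eq_bigr => be _.
  under eq_bigr => mu _ do rewrite dual_Ricci_h mulrDr mulrN.
  rewrite big_split /= sumrN; over.
rewrite big_split /= sumrN (sum_sym_skew ginvh_sym skew) addr0.
by [].
Qed.

Lemma dual_scalar_v :
  \sum_b \sum_d ginvv N lam b d p * (\sum_a curvSv N Dt a b d a p) =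
  - \sum_d cov10 dv (Cv D) (contrv_up N lam) d d p.
Proof.
have dC b : differentiable (contrv N lam b) p.
  by apply: differentiable_fun_sum => a; exact: dT.
have -> : \sum_d cov10 dv (Cv D) (contrv_up N lam) d d p =
    \sum_b \sum_a ginvv N lam b a p *
      cov01 dv (Cv D) (contrv N lam) a b p.
  exact: (divergence_raise dginvv dC ginvv_sym vf_act_ginvv).
rewrite -sumrN; apply: eq_bigr => b _; rewrite -sumrN; apply: eq_bigr => d _.
by rewrite dual_Ricci_v mulrN.
Qed.

End DualCurvature.

(** * Application to an induced chart *)

Lemma tdom_open (R : realType) (n : nat) (M : smooth_manifold R n)
  (k : atlas M) : open (tdom k).
Proof.
apply: (@open_comp _ _ fst); last exact: cimg_open.
by move=> q _; exact: cvg_fst.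
Qed.

Theorem theorem3p5 (R : realType) (n : nat) (M : smooth_manifold R n)
    (E : EAP_space M) (k : atlas M) :
  let N := nlc E k in
  let lam := fun i => lambda E i k in
  let D := canonical_dconn N lam in
  let Dt := dual_dconn D in
  let Rnl := nlcurv N in
  let L := torsh N lam in
  let P := torsP N lam in
  let T := torsv N lam in
  let Clh := contrh N lam in
  let Clv := contrv N lam in
  let Cuh := contrh_up N lam in
  let Cuv := contrv_up N lam in
  let Rt := fun be nu p => \sum_al curvRh N Dt al be nu al p in
  let Rscal := fun p => \sum_be \sum_mu ginvh lam be mu p * Rt be mu p in
  let Pth := fun be c p => - \sum_al curvPh N Dt al be al c p in
  let Ptv := fun b mu p => \sum_a curvPv N Dt a b mu a p in
  let St := fun b d p => \sum_a curvSv N Dt a b d a p in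
  let Sscal := fun p => \sum_b \sum_d ginvv N lam b d p * St b d p in
  forall p : tcoord R n, tdom k p ->
  (forall al be b c : 'I_n, curvSh N Dt al be b c p = 0) /\
  (forall al be nu mu : 'I_n,
     curvRh N Dt al be nu mu p =
     cov12 (dh N) (Gh D) L al mu nu be p
     + (\sum_a Ch D al be a p * Rnl a mu nu p
        + \sum_a Ch D al mu a p * Rnl a nu be p
        + \sum_a Ch D al nu a p * Rnl a be mu p)) /\
  (forall a b nu mu : 'I_n,
     curvRv N Dt a b nu mu p = \sum_d Rnl d mu nu p * T a d b p) /\
  (forall al be mu c : 'I_n,
     curvPh N Dt al be mu c p =
     cov12 dv (Ch D) L al mu be c p
     + \sum_ep L al ep be p * Ch D ep mu c p) /\
  (forall a b mu c : 'I_n,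
     curvPv N Dt a b mu c p =
     cov12 (dh N) (Gv D) T a b c mu p + \sum_d T a d b p * P d mu c p) /\
  (forall a b c d : 'I_n,
     curvSv N Dt a b c d p = cov12 dv (Cv D) T a d c b p) /\
  (forall be nu : 'I_n,
     Rt be nu p =
     - cov01 (dh N) (Gh D) Clh nu be p
     + \sum_al (\sum_a Ch D al be a p * Rnl a al nu p
                + \sum_a Ch D al nu a p * Rnl a be al p
                + \sum_a Ch D al al a p * Rnl a nu be p)) /\
  (Rscal p = - \sum_mu cov10 (dh N) (Gh D) Cuh mu mu p) /\
  (forall be c : 'I_n,
     Pth be c p =
     cov01 dv (Ch D) Clh be c p
     + \sum_al \sum_ep L al be ep p * Ch D ep al c p) /\
  (forall b mu : 'I_n,
     Ptv b mu p =
     cov01 (dh N) (Gv D) Clv b mu p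
     + \sum_a \sum_d T a d b p * P d mu a p) /\
  (forall b d : 'I_n, St b d p = - cov01 dv (Cv D) Clv d b p) /\
  (Sscal p = - \sum_d cov10 dv (Cv D) Cuv d d p).
Proof.
move=> N lam D Dt Rnl L P T Clh Clv Cuh Cuv Rt Rscal Pth Ptv St Sscal p kp.
(* All identities are local: openness of [tdom k] turns smoothness and linear independence on the
   chart domain into the four conditions at and near [p] used above. *)
have Uk : \forall q \near p, tdom k q.
  by apply: open_nbhs_nbhs; split; first exact: tdom_open.
have cN a mu : twice_differentiable (N a mu) p.
  apply: (@smooth_on_twice_differentiable _ _ _ (tdom k)) => //.
    exact: tdom_open.
  exact: nl_smooth.
have clam i j : twice_differentiable (fun q => tcoef j (lam i q)) p.
  apply: twice_differentiable_lin; first exact: tcoef_continuous.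
  apply: (@smooth_on_twice_differentiable _ _ _ (tdom k)) => //.
    exact: tdom_open.
  exact: vf_smooth.
have uh : \forall q \near p, lamh_mx lam q \in unitmx.
  by apply: filterS Uk => q /(lambda_hfree E); rewrite row_free_unit.
have uv : \forall q \near p, lamv_mx N lam q \in unitmx.
  by apply: filterS Uk => q /(lambda_vfree E); rewrite row_free_unit.
split; first by move=> *; exact: dual_curvSh.
split; first by move=> *; exact: dual_curvRh.
split; first by move=> *; exact: dual_curvRv.
split; first by move=> *; exact: dual_curvPh.
split; first by move=> *; exact: dual_curvPv.
split; first by move=> *; exact: dual_curvSv.
split; first by move=> *; exact: dual_Ricci_h.
split; first exact: dual_scalar_h.
split; first by move=> *; exact: dual_Ricci_hv.
split; first by move=> *; exact: dual_Ricci_vh.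
split; first by move=> *; exact: dual_Ricci_v.
exact: dual_scalar_v.
Qed.
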